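(* Let $(G,S)$ be a right-angled Artin group and let $w\in G$. Then there exist primitive elements $p_1,\dots,p_n$ of $G$ (with $n\ge 0$) and positive integers $m_1,\dots,m_n$ such that $a^{-1}p_ia\perp a^{-1}p_ja$ for all $i\ne j$ and all $a\in X_w$ (in particular, the $p_i$ are commuting primitive elements), and $$w=\prod_{i=1}^{n}p_i^{m_i}.$$ The pairs $(p_i,m_i)$ are uniquely determined by these requirements, up to a permutation of the indices $i=1,\dots,n$.
   Context: $(G,S)$ is a right-angled Artin group: $S\subseteq G$ is a (possibly infinite) generating set of the group $G$ with $S\cap S^{-1}=\emptyset$, and $G$ has the presentation $\langle S\,;\,[s,t]=1$ for those $s\neq t$ in $S$ with $st=ts$ in $G\rangle$. Let $l$ be the word length on $G$ with respect to $S\cup S^{-1}$. Write $x\subset y$ iff $l(x)+l(x^{-1}y)=l(y)$; this is a partial order with least element $1$, in which any two elements have a greatest lower bound $x\cap y$. Elements $x,y$ are orthogonal, $x\perp y$, if $x\cap y=1$ and $x,y$ have a least upper bound for $\subset$ (equivalently, a common upper bound). Put $[x,y]=\{z\in G: x^{-1}z\subset x^{-1}y\}$ and $Y(x,y,z)=x(x^{-1}y\cap x^{-1}z)$, the unique element of $[x,y]\cap[y,z]\cap[z,x]$. A subset $I$ is convex if $[x,y]\subseteq I$ for all $x,y\in I$; the convex closure of a set is the smallest convex set containing it. An element $w$ is cyclically reduced if $w\cap w^{-1}=1$. For $w\in G$ put $\varphi_w(x)=Y(wx,x,w^{-1}x)$ and $X_w=\varphi_w(G)=\{x\in G: x^{-1}wx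 \text{ is cyclically reduced}\}$. For a cyclically reduced $v\in G$ let $X_{v,1}$ be the convex closure of $\{v^n:n\in\mathbb Z\}$ and $H_v=Z_G(v)\cap X_{v,1}$ (a subgroup of the centralizer $Z_G(v)$). An element $w\ne 1$ is called primitive if for some (equivalently, for all) $a\in X_w$ the group $H_{a^{-1}wa}$ is cyclic, generated by $a^{-1}wa$. *)

(* Defs.v *)
From HB Require Import structures.
From mathcomp Require Import all_boot.
From mathcomp Require Import boolp classical_sets.
Set Implicit Arguments.
Unset Strict Implicit.
Unset Printing Implicit Defensive.
Local Open Scope classical_set_scope.
Local Open Scope group_scope.

(* The letter (s, false) stands for s and (s, true) for its inverse. *)
Definition word (X : Type) := seq (X * bool).

Definition inv_letter (X : Type) (l : X * bool) : X * bool := (l.1, ~~ l.2).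

(* u and v represent the same element of the group < X ; R >. *)
Inductive pres_eq (X : Type) (R : set (word X)) : word X -> word X -> Prop :=
| pres_refl u : pres_eq R u u
| pres_sym u v : pres_eq R u v -> pres_eq R v u
| pres_trans u v w : pres_eq R u v -> pres_eq R v w -> pres_eq R u w
| pres_cancel u l v : pres_eq R (u ++ [:: l; inv_letter l] ++ v) (u ++ v)
| pres_relator u r v : R r -> pres_eq R (u ++ r ++ v) (u ++ v).

Section RightAngledArtin.
Variables (G : groupType) (S : set G).
Implicit Types (x y z v w : G) (A : set G).

Definition letter_val (l : S * bool) : G :=
  if l.2 then (val l.1)^-1 else val l.1.

Definition word_val (u : word S) : G := \prod_(l <- u) letter_val l.

Definition raag_relators : set (word S) :=
  [set r | exists s t : S, [/\ s <> t, commute (val s) (val t) &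
     r = [:: (s, false); (t, false); (s, true); (t, true)]]].

Definition right_angled_artin : Prop :=
  [/\ S `&` [set x^-1 | x in S] = set0,
      (forall x, exists u : word S, word_val u = x) &
      forall u : word S, word_val u = 1 <-> pres_eq raag_relators u [::]].

Definition wlen x : nat :=
  xget 0%N [set n | (exists2 u : word S, word_val u = x & size u = n) /\
                    (forall u : word S, word_val u = x -> (n <= size u)%N)].

Definition prefix_le x y : Prop := (wlen x + wlen (x^-1 * y))%N = wlen y.

Definition is_glb x y z : Prop :=
  [/\ prefix_le z x, prefix_le z y &
      forall t, prefix_le t x -> prefix_le t y -> prefix_le t z].

Definition is_lub x y z : Prop :=
  [/\ prefix_le x z, prefix_le y z &
      forall t, prefix_le x t -> prefix_le y t -> prefix_le z t].

(* In a right-angled Artin group the greatest lower bound always exists, so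
   that the default value 1 of xget is irrelevant. *)
Definition meet x y : G := xget 1 (is_glb x y).

Definition orthogonal x y : Prop := meet x y = 1 /\ exists z, is_lub x y z.

Definition interval x y : set G := [set z | prefix_le (x^-1 * z) (x^-1 * y)].

Definition median x y z : G := x * meet (x^-1 * y) (x^-1 * z).

Definition convex A : Prop := forall x y, A x -> A y -> interval x y `<=` A.

Definition convex_closure A : set G := smallest convex A.

Definition cyclically_reduced w : Prop := meet w w^-1 = 1.

Definition phi w x : G := median (w * x) x (w^-1 * x).

Definition axis w : set G := range (phi w).

Definition zpowers v : set G := [set x | exists n, x = v ^+ n \/ x = v ^- n].

Definition centralizer v : set G := [set x | commute x v].

(* The sets X_{v,1} and H_v; only meaningful for v cyclically reduced. *)
Definition axis1 v : set G := convex_closure (zpowers v).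

Definition axis_group v : set G := centralizer v `&` axis1 v.

Definition primitive w : Prop :=
  w <> 1 /\ exists2 a, axis w a &
              axis_group (a^-1 * w * a) = zpowers (a^-1 * w * a).

Definition primitive_decomposition w n (p : 'I_n -> G) (m : 'I_n -> nat) :=
  [/\ forall i, primitive (p i),
      forall i, (0 < m i)%N,
      forall i j a, i <> j -> axis w a ->
        orthogonal (a^-1 * p i * a) (a^-1 * p j * a) &
      w = \prod_(i < n) p i ^+ m i].

End RightAngledArtin.

(* Main.v *)
(* Words are compared up to commutation through their projections to pairs of
   dependent generators; free reduction is confluent for this equivalence, so
   each element of G is a reduced trace, unique up to commutation, and word
   length, prefixes, greatest lower bounds and supports are read off from it.
   Two elements are orthogonal iff their supports commute letter by letter, and
   v is cyclically reduced iff the product v * v is reduced; the axis of w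
   consists of the a such that w ^ a is cyclically reduced.

   A cyclically reduced v splits into orthogonal factors until each is
   irreducible, i.e. its support is connected for non-commutation. If v is
   irreducible and x, with support in that of v, satisfies xv = vx as traces,
   then all projections of x and v are powers of common words with proportional
   letter counts, so such traces x are the powers of a single root. An element
   h of the axis group becomes such an x after multiplication by a large power
   of v; hence the root is primitive. Conversely the factors of any
   decomposition have the connected components of the support as supports, so
   their powers are determined by v, and r^m = r'^m' forces r and r' to commute
   (look at projections), whence r = r' by primitivity. Passing between two
   points of the axis is a sequence of cyclic shifts inside single factors,
   which preserves supports and primitivity. *)
Require Import Defs.
From mathcomp Require Import all_boot.
From mathcomp Require Import boolp classical_sets zify.
Set Implicit Arguments.
Unset Strict Implicit.
Unset Printing Implicit Defensive.

(** * Commuting words in a free monoid *)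

(** Commuting words are powers of a common word. Stripping the shorter word off the longer, as in
    Euclid's algorithm, gives the proportionality without naming that word. *)
Lemma seq_commute_count (T : eqType) (x v : seq T) (p : pred T) :
  x ++ v = v ++ x -> size v * count p x = size x * count p v.
Proof.
elim: {x v}(size x + size v).+1 {-2}x {-2}v (ltnSn (size x + size v)) => //.
move=> n IH x v; rewrite ltnS.
wlog le : x v / size v <= size x => [W len e|].
  have [l|/ltnW l] := leqP (size v) (size x); first exact: W.
  by apply/esym; apply: W => //; rewrite addnC.
case: v le => [|a v] le len e; first by rewrite cats0 in e; rewrite muln0.
have ex : x = (a :: v) ++ drop (size v).+1 x.
  rewrite -{1}(cat_take_drop (size v).+1 x); congr (_ ++ _).
  have := congr1 (take (size v).+1) e.
  by rewrite takel_cat // take_size_cat.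
move: e len le; rewrite ex; set y := drop _ _ => e len le.
have {}e : y ++ a :: v = (a :: v) ++ y.
  by move/eqP: e; rewrite -catA eqseq_cat // eqxx => /eqP.
have := IH y (a :: v); rewrite count_cat size_cat mulnDr mulnDl => -> //.
by move: len; rewrite size_cat /=; lia.
Qed.

(** [u] commutes with every power of [v], and the exponent [size u] makes the power at least as long
    as [u] because [v] is nonempty. *)
Lemma seq_pow_prefix (T : eqType) (u v : seq T) :
  v <> [::] -> u ++ v = v ++ u ->
  exists z, flatten (nseq (size u) v) = u ++ z.
Proof.
move=> v0 e.
have c k : u ++ flatten (nseq k v) = flatten (nseq k v) ++ u.
  by elim: k => [|k IH]; rewrite ?cats0 //= catA e -!catA IH.
have le k : k <= size (flatten (nseq k v)).
  elim: k => //= k IH.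
  by rewrite size_cat -addn1 addnC leq_add //; case: (v) v0.
exists (drop (size u) (flatten (nseq (size u) v))).
rewrite -{1}(cat_take_drop (size u) (flatten _)); congr (_ ++ _).
have := congr1 (take (size u)) (c (size u)); by rewrite take_size_cat // takel_cat.
Qed.

(** Both words are prefixes of powers of [v], and two prefixes of one long power are comparable. *)
Lemma seq_commute_prefix (T : eqType) (r x v : seq T) :
  v <> [::] -> r ++ v = v ++ r -> x ++ v = v ++ x -> size r <= size x ->
  exists z, x = r ++ z.
Proof.
move=> v0 /(seq_pow_prefix v0)[zr er] /(seq_pow_prefix v0)[zx ex] le.
exists (drop (size r) x); rewrite -{1}(cat_take_drop (size r) x); congr (_ ++ _).
have := congr1 (take (size r)) ex; rewrite takel_cat // => <-.
by rewrite -(subnKC le) nseqD flatten_cat er -catA take_size_cat.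
Qed.

(** Both words commute with the common power [z], so [z ++ z] has the prefixes [u ++ v] and
    [v ++ u], of equal length. *)
Lemma seq_eq_pow_commute (T : eqType) (u v : seq T) m n :
  flatten (nseq m.+1 u) = flatten (nseq n.+1 v) -> u ++ v = v ++ u.
Proof.
set z := flatten _ => e.
have c k w : w ++ flatten (nseq k w) = flatten (nseq k w) ++ w :> seq T.
  by elim: k => [|k IH]; rewrite ?cats0 //= -catA -IH.
have cu : u ++ z = z ++ u by exact: c.
have cv : v ++ z = z ++ v by rewrite e; exact: c.
have zu : z = u ++ flatten (nseq m u) by [].
have zv : z = v ++ flatten (nseq n v) by [].
have p1 : z ++ z = (u ++ v) ++ flatten (nseq n v) ++ flatten (nseq m u).
  by rewrite {2}zu catA -cu {1}zv !catA.
have p2 : z ++ z = (v ++ u) ++ flatten (nseq m u) ++ flatten (nseq n v).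
  by rewrite {2}zv catA -cv {1}zu !catA.
move/eqP: p1; rewrite p2 eqseq_cat; first by move=> /andP[/eqP].
by rewrite !size_cat addnC.
Qed.

(** * Traces: words up to commutation of independent generators *)

Record commutation (X : eqType) := Commutation {
  comm_rel :> rel X;
  comm_sym : symmetric comm_rel;
  comm_irr : irreflexive comm_rel }.

Section Traces.
Variables (X : eqType) (ind : commutation X).
Implicit Types (a b c : X * bool) (u v w p q : seq (X * bool)) (s t : X).

Let ind_sym : symmetric ind := @comm_sym _ ind.
Let ind_irr : irreflexive ind := @comm_irr _ ind.

Definition proj s t u := [seq l : X * bool <- u | (l.1 == s) || (l.1 == t)].

(* Trace equivalence: equality of all projections to pairs of dependent
   generators; s = t is allowed, as ind is irreflexive. *)
Definition teq u v := forall s t, ~~ ind s t -> proj s t u = proj s t v.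

Lemma teq_refl u : teq u u. Proof. by []. Qed.
Hint Resolve teq_refl : core.

Lemma teq_sym u v : teq u v -> teq v u.
Proof. by move=> h s t d; rewrite h. Qed.

Lemma teq_trans v u w : teq u v -> teq v w -> teq u w.
Proof. by move=> h k s t d; rewrite h // k. Qed.

Lemma teq_cat u u' v v' : teq u u' -> teq v v' -> teq (u ++ v) (u' ++ v').
Proof. by move=> h k s t d; have := h s t d; have := k s t d; rewrite /proj !filter_cat => -> ->. Qed.

Lemma teq_cons a u v : teq u v -> teq (a :: u) (a :: v).
Proof. exact: (@teq_cat [:: a] [:: a]). Qed.

Lemma teq_catI u v w : teq (u ++ v) (u ++ w) -> teq v w.
Proof.
move=> h s t d; have := h s t d; rewrite /proj !filter_cat => /eqP.
by rewrite eqseq_cat // eqxx => /eqP.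
Qed.

Lemma teq_consI a u v : teq (a :: u) (a :: v) -> teq u v.
Proof. exact: (@teq_catI [:: a]). Qed.

Lemma teq_swap a b u : ind a.1 b.1 -> teq (a :: b :: u) (b :: a :: u).
Proof.
move=> i s t d; rewrite /proj /=.
case: (altP (a.1 =P s)) => [as_|_]; case: (altP (a.1 =P t)) => [at_|_];
case: (altP (b.1 =P s)) => [bs_|_]; case: (altP (b.1 =P t)) => [bt_|_] //=;
by move: i d; rewrite ?as_ ?at_ ?bs_ ?bt_ ?ind_irr // => i; rewrite ?i // ind_sym i.
Qed.

Lemma teq_nil u : teq [::] u -> u = [::].
Proof. by case: u => // a u /(_ a.1 a.1); rewrite ind_irr /= eqxx => /(_ isT). Qed.

Lemma teq_mem u v : teq u v -> u =i v.
Proof.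
move=> h l; have := h l.1 l.1; rewrite ind_irr => /(_ isT) e.
have f z : (l \in z) = (l \in proj l.1 l.1 z) by rewrite mem_filter eqxx.
by rewrite f e -f.
Qed.

Definition indw s u := all (fun l : X * bool => ind s l.1) u.

Lemma teq_indw s u v : teq u v -> indw s u = indw s v.
Proof. by move=> h; apply: eq_all_r; apply: teq_mem. Qed.

Lemma teq_indw_cat a u : indw a.1 u -> teq (a :: u) (u ++ [:: a]).
Proof.
elim: u => //= b u IH /andP[i j].
by apply: teq_trans (teq_swap _ i) _; apply: teq_cons; exact: IH.
Qed.

(* b can be moved to the front of u by commutations. *)
Fixpoint starts b u :=
  if u is c :: u' then (c == b) || ind b.1 c.1 && starts b u' else false.

Lemma starts_cat b u v :
  starts b (u ++ v) = starts b u || indw b.1 u && starts b v.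
Proof.
elim: u => //= c u ->.
by case: eqP => // _; case: (ind b.1 c.1).
Qed.

Lemma starts_mem b u : starts b u -> b \in u.
Proof.
elim: u => //= c u IH /orP[/eqP->|/andP[_ /IH h]]; first exact: mem_head.
by rewrite inE h orbT.
Qed.

Lemma startsN b u : starts b u -> indw b.1 u = false.
Proof.
move=> /starts_mem h; apply/negP => /allP/(_ _ h).
by rewrite ind_irr.
Qed.

Lemma starts_rem b u : starts b u -> teq u (b :: rem b u).
Proof.
elim: u => //= c u IH; case: eqP => [-> //|_ /andP[i /IH h]].
apply: teq_trans (teq_cons _ h) _; apply: teq_swap; by rewrite ind_sym.
Qed.

(** Only a dependent letter standing before [b] can keep it from the front, and that letter would
    precede [b] in the projection to the two generators. *)
Lemma proj_starts b u :
  (forall t, ~~ ind b.1 t -> exists z, proj b.1 t u = b :: z) -> starts b u.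
Proof.
elim: u => [|c u IH] h; first by have [|z] := h b.1; rewrite ?ind_irr.
rewrite /=; case: eqP => //= cb; case i: (ind b.1 c.1) => /=; last first.
  by have [|z] := h c.1; rewrite ?i // /proj /= eqxx orbT => -[].
apply: IH => t d; have [z] := h t d; rewrite /proj /=.
have -> : c.1 == b.1 = false by case: eqP i => // ->; rewrite ind_irr.
have -> : c.1 == t = false by case: eqP i d => // -> ->.
by exists z.
Qed.

Lemma teq_starts_cons b u v : teq u (b :: v) -> starts b u.
Proof.
move=> h; apply: proj_starts => t d; exists (proj b.1 t v).
by rewrite h // /proj /= eqxx.
Qed.

Lemma teq_starts b u v : teq u v -> starts b u = starts b v.
Proof.
move=> h; apply/idP/idP => /starts_rem k.
  by apply: teq_starts_cons (teq_trans (teq_sym h) k).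
by apply: teq_starts_cons (teq_trans h k).
Qed.

Lemma teq_rem b u v : teq u v -> starts b u -> teq (rem b u) (rem b v).
Proof.
move=> h k; apply: (@teq_consI b).
apply: teq_trans (teq_sym (starts_rem k)) _; apply: (teq_trans h).
by apply: starts_rem; rewrite -(teq_starts _ h).
Qed.

Lemma teq_perm u v : teq u v -> perm_eq u v.
Proof.
elim: u v => [v /teq_nil -> //|a u IH v h].
have k : starts a v by rewrite -(teq_starts _ h) /= eqxx.
rewrite perm_sym (permPl (perm_to_rem (starts_mem k))) perm_sym perm_cons.
apply: IH; apply: (@teq_consI a); exact: teq_trans h (starts_rem k).
Qed.

Lemma teq_size u v : teq u v -> size u = size v.
Proof. by move/teq_perm/perm_size. Qed.

(** * Reduced words *)

Local Notation inv := (@inv_letter X).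

Lemma inv_letterK : involutive inv.
Proof. by case=> s e; rewrite /inv_letter /= negbK. Qed.

Lemma inv_letter_neq a : (inv a == a) = false.
Proof. by case: a => s [] /=; rewrite /eq_op /= eqxx. Qed.

(** Reducedness modulo commutation: no letter has its inverse movable to the place right behind
    it. *)
Fixpoint reduced u :=
  if u is a :: u' then ~~ starts (inv a) u' && reduced u' else true.

Lemma ind_neq a b : ind a.1 b.1 -> (a == b = false) * (b == a = false).
Proof.
move=> i; rewrite [b == a]eq_sym; suff -> : a == b = false by [].
by case: eqP i => // ->; rewrite ind_irr.
Qed.

Lemma ind_inv_neq a b : ind a.1 b.1 -> inv a == b = false.
Proof. by move=> i; case: eqP i => // <-; rewrite ind_irr. Qed.

Lemma reduced_rem b u : starts b u -> reduced u -> reduced (b :: rem b u).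
Proof.
elim: u => // c u IH /=; case: (altP (c =P b)) => [->//|cb] /= /andP[i k].
move=> /andP[nc ru]; have /= /andP[h1 h2] := IH k ru.
rewrite h2 andbT; apply/andP; split.
  rewrite negb_or eq_sym ind_inv_neq //=.
  by rewrite negb_and h1 orbT.
move: nc; rewrite (teq_starts _ (starts_rem k)) /= (ind_sym c.1) i /=.
by rewrite negb_or => /andP[].
Qed.

Lemma teq_reduced u v : teq u v -> reduced u = reduced v.
Proof.
suff imp u' v' : teq u' v' -> reduced u' -> reduced v'.
  by move=> h; apply/idP/idP; apply: imp => //; apply: teq_sym.
elim: v' u' => // b v' IH u' h ru.
have k : starts b u' by rewrite (teq_starts _ h) /= eqxx.
have /= /andP[h1 h2] := reduced_rem k ru.
have e : teq (rem b u') v'.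
  by have := teq_rem h k; rewrite /= eqxx.
by rewrite /= -(teq_starts _ e) h1 (IH _ e).
Qed.

(** Left multiplication by a letter on reduced traces. By [ins_invK] and [insC] these maps respect
    the relations of the group, as in van der Waerden's proof of the uniqueness of normal forms. *)
Definition ins a u := if starts (inv a) u then rem (inv a) u else a :: u.

Lemma reduced_ins a u : reduced u -> reduced (ins a u).
Proof.
rewrite /ins => ru; case: ifP => [k|/= ->//].
by have /= /andP[] := reduced_rem k ru.
Qed.

Lemma teq_ins a u v : teq u v -> teq (ins a u) (ins a v).
Proof.
move=> h; rewrite /ins -(teq_starts _ h); case: ifP => [k|_].
  exact: teq_rem.
exact: teq_cons.
Qed.

Lemma ins_invK a u : reduced u -> teq (ins a (ins (inv a) u)) u.
Proof.
move=> ru; rewrite [ins (inv a) u]/ins inv_letterK; case: ifP => k.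
  have /= /andP[h1 h2] := reduced_rem k ru.
  by rewrite /ins (negbTE h1); apply: teq_sym; apply: starts_rem.
by rewrite /ins /= eqxx.
Qed.

Lemma insC a b u : ind a.1 b.1 -> teq (ins a (ins b u)) (ins b (ins a u)).
Proof.
move=> i; have j : ind b.1 a.1 by rewrite ind_sym.
have sI c d w : ind c.1 d.1 -> starts d w -> starts c (rem d w) = starts c w.
  move=> cd k; rewrite [RHS](teq_starts _ (starts_rem k)) /= cd.
  by rewrite (ind_neq cd).
have sC c d w : ind c.1 d.1 -> starts (inv c) (d :: w) = starts (inv c) w.
  by move=> cd /=; rewrite cd eq_sym ind_inv_neq.
have rC c d w : ind c.1 d.1 -> rem (inv c) (d :: w) = d :: rem (inv c) w.
  by move=> cd /=; rewrite eq_sym ind_inv_neq.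
rewrite /ins; case: (boolP (starts (inv b) u)) => kb;
case: (boolP (starts (inv a) u)) => ka.
- rewrite !sI // ka kb.
  have ka' : starts (inv a) (rem (inv b) u) by rewrite sI.
  have kb' : starts (inv b) (rem (inv a) u) by rewrite sI.
  (* Both letters cancel: the two results are compared after putting both inverses back in front,
     which turns each side into [u]. *)
  apply: (@teq_consI (inv a)); apply: (@teq_consI (inv b)).
  apply: teq_trans (teq_cons _ (teq_sym (starts_rem ka'))) _.
  apply: teq_trans (teq_sym (starts_rem kb)) _.
  apply: teq_trans (starts_rem ka) _.
  apply: teq_trans (teq_cons _ (starts_rem kb')) _.
  exact: teq_swap.
- by rewrite sI // (negbTE ka) sC // kb rC.
- by rewrite sC // ka sI // (negbTE kb) rC.
- by rewrite !sC // (negbTE ka) (negbTE kb); apply: teq_swap.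
Qed.

Definition nf u := foldr ins [::] u.

Lemma reduced_nf u : reduced (nf u).
Proof. by elim: u => //= a u IH; apply: reduced_ins. Qed.

Lemma nf_reduced u : reduced u -> nf u = u.
Proof. by elim: u => //= a u IH /andP[h /IH->]; rewrite /ins (negbTE h). Qed.

Lemma nf_cat u v : nf (u ++ v) = foldr ins (nf v) u.
Proof. by rewrite /nf foldr_cat. Qed.

Lemma teq_foldr_ins u v w : teq v w -> teq (foldr ins v u) (foldr ins w u).
Proof. by move=> h; elim: u => //= a u; apply: teq_ins. Qed.

Lemma size_ins a u : size (ins a u) <= (size u).+1 ?= iff ~~ starts (inv a) u.
Proof.
rewrite /ins; case: ifP => k /=; last exact/leqif_refl.
rewrite size_rem ?starts_mem //; split.
  by apply: leq_trans (leq_pred _) (leqnSn _).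
by apply/negbTE; rewrite neq_ltn ltnS leq_pred.
Qed.

Lemma size_nf u : size (nf u) <= size u.
Proof.
elim: u => //= a u IH; apply: leq_trans (size_ins _ _) _; exact: IH.
Qed.

Lemma reduced_size u : size (nf u) = size u -> reduced u.
Proof.
elim: u => //= a u IH e.
have h := size_ins a (nf u).
have l := size_nf u.
have e1 : size (nf u) = size u.
  by apply/eqP; rewrite eqn_leq l -ltnS -e; exact: h.
have r := IH e1; rewrite r andbT.
by have := h.2; rewrite (nf_reduced r) in e e1 *; rewrite e eqxx => <-.
Qed.

Lemma reduced_cat u v : reduced (u ++ v) -> reduced u /\ reduced v.
Proof.
elim: u => //= a u IH /andP[+ /IH[-> ->]].
by rewrite starts_cat negb_or => /andP[->].
Qed.

Definition winv u : seq (X * bool) := rev (map inv u).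

Lemma winv_cons a u : winv (a :: u) = winv u ++ [:: inv a].
Proof. by rewrite /winv /= rev_cons cats1. Qed.

Lemma indw_winv s u : indw s (winv u) = indw s u.
Proof. by rewrite /indw all_rev all_map. Qed.

(** [starts b (winv u)] says that the inverse of [b] can be moved to the end of [u], so the
    hypothesis excludes a cancellation at the junction. *)
Lemma reduced_catP u v : reduced u -> reduced v ->
  (forall b, starts b (winv u) -> ~~ starts b v) -> reduced (u ++ v).
Proof.
move=> + rv; elim: u => //= a u IH /andP[na ru] h.
rewrite IH // ?andbT; last first.
  by move=> b k; apply: h; rewrite winv_cons starts_cat k.
rewrite starts_cat (negbTE na) /=; apply/negP => /andP[i k].
suff : ~~ starts (inv a) v by rewrite k.
by apply: h; rewrite winv_cons starts_cat indw_winv i /= eqxx orbT.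
Qed.

Lemma reduced_catN b u v :
  reduced (u ++ v) -> starts b (winv u) -> ~~ starts b v.
Proof.
elim: u => //= a u IH /andP[n r]; rewrite winv_cons starts_cat => /orP[h|].
  exact: IH.
rewrite indw_winv /= andbF orbF => /andP[i /eqP e].
by move: n; rewrite e starts_cat i /=; case: starts; rewrite ?orbT.
Qed.

(** * Restriction to a set of generators *)

Definition res (A : pred X) u := [seq l : X * bool <- u | A l.1].

Lemma res_proj A s t u : proj s t (res A u) = res A (proj s t u).
Proof. by rewrite /proj /res -!filter_predI; apply: eq_filter => l /=; rewrite andbC. Qed.

Lemma teq_res A u v : teq u v -> teq (res A u) (res A v).
Proof. by move=> h s t d; rewrite !res_proj h. Qed.

Lemma res_id (A : pred X) u : (forall l, l \in u -> A l.1) -> res A u = u.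
Proof. by move=> h; apply/all_filterP/allP. Qed.

Lemma res_nil (A : pred X) u : (forall l, l \in u -> ~~ A l.1) -> res A u = [::].
Proof.
move=> h; apply/eqP; rewrite -size_eq0 size_filter -leqn0 leqNgt -has_count.
by apply/hasPn.
Qed.

Lemma res_split (A : pred X) u :
  (forall l m, l \in u -> m \in u -> A l.1 -> ~~ A m.1 -> ind l.1 m.1) ->
  teq u (res A u ++ res (predC A) u).
Proof.
elim: u => //= a u IH h.
have {}IH : teq u (res A u ++ res (predC A) u).
  by apply: IH => l m hl hm; apply: h; rewrite inE ?hl ?hm orbT.
apply: teq_trans (teq_cons a IH) _; rewrite -[_ (a.1)]/(A a.1).
case Aa : (A a.1) => //=.
have i : indw a.1 (res A u).
  apply/allP => l; rewrite mem_filter => /andP[Al lu]; rewrite ind_sym.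
  by apply: h => //; rewrite ?inE ?eqxx ?lu ?orbT ?Aa.
have := teq_cat (teq_indw_cat i) (teq_refl (res (predC A) u)).
by rewrite -catA.
Qed.

(** * Powers and roots of traces *)

(** The first letter of [u] leads all projections of [v] that involve it, hence can be moved to the
    front of [v] and stripped off. *)
Lemma proj_prefix u v :
  (forall s t, ~~ ind s t -> exists z, proj s t v = proj s t u ++ z) ->
  exists y, teq v (u ++ y).
Proof.
elim: u v => [v _|a u IH v h]; first by exists v.
have k : starts a v.
  apply: proj_starts => t d; have [z] := h _ _ d.
  by rewrite /proj /= eqxx /= => ->; eexists.
have [s t d|y e] := IH (rem a v).
  have [z] := h s t d; rewrite (starts_rem k d) /proj /=.
  by case: (_ || _) => [[]|] ez; exists z.
by exists y; apply: teq_trans (starts_rem k) _; apply: teq_cons.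
Qed.

Definition tpow n u := flatten (nseq n u) : seq (X * bool).

Lemma tpowS n u : tpow n.+1 u = u ++ tpow n u. Proof. by []. Qed.

Lemma proj_tpow s t n u : proj s t (tpow n u) = flatten (nseq n (proj s t u)).
Proof. by rewrite /proj /tpow filter_flatten map_nseq. Qed.

Lemma eq_pow_commute u v m n : teq (tpow m.+1 u) (tpow n.+1 v) ->
  teq (u ++ v) (v ++ u).
Proof.
move=> h s t d; have := h s t d; rewrite !proj_tpow.
by rewrite /proj !filter_cat => /seq_eq_pow_commute.
Qed.

Definition gens u := [seq l.1 | l : X * bool <- u].

Definition cnt s u := count_mem s (gens u).

Lemma cnt_proj s t u : cnt s (proj s t u) = cnt s u.
Proof.
rewrite /cnt /gens !count_map /proj count_filter; apply: eq_count => l /=.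
by case: eqP.
Qed.

Lemma size_proj s t u : size (proj s t u) = if s == t then cnt s u else cnt s u + cnt t u.
Proof.
rewrite size_filter /cnt /gens !count_map; case: eqP => [<-|ne].
  by apply: eq_count => l /=; rewrite orbb.
rewrite -count_predUI [X in _ + X](_ : _ = 0) ?addn0 //.
by apply/eqP; rewrite -leqn0 leqNgt -has_count; apply/hasPn => l _ /=; case: eqP => // ->; apply/eqP.
Qed.

Lemma cnt_gt0 s u : (0 < cnt s u) = (s \in gens u).
Proof. by rewrite -has_count has_pred1. Qed.

Lemma teq_gens u v : teq u v -> gens u =i gens v.
Proof. by move=> h; apply: perm_mem; apply: perm_map; apply: teq_perm. Qed.

Lemma gens_cat u v : gens (u ++ v) = gens u ++ gens v.
Proof. exact: map_cat. Qed.

Lemma commute_cnt s t x v : ~~ ind s t -> teq (x ++ v) (v ++ x) ->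
  cnt s x * cnt t v = cnt t x * cnt s v.
Proof.
move=> d h; have [->|ne] := eqVneq s t; first by [].
have := h s t d; rewrite /proj !filter_cat => /seq_commute_count.
move=> /(_ (fun l => l.1 == s)); rewrite -!/(proj s t _) !size_proj (negbTE ne).
have e u : count (fun l : X * bool => l.1 == s) (proj s t u) = cnt s u.
  by rewrite -(cnt_proj s t) /cnt /gens count_map.
rewrite !e !mulnDl [X in _ = X + _]mulnC => /addnI; by rewrite mulnC.
Qed.

(** Connectedness of the support for non-commutation: no set of generators separates the letters of
    [v] into two nonempty commuting parts. *)
Definition irreducible v := forall A : pred X,
  (forall l m, l \in v -> m \in v -> A l.1 -> ~~ A m.1 -> ind l.1 m.1) ->
  (forall l, l \in v -> A l.1) \/ (forall l, l \in v -> ~~ A l.1).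

(** Commutation is meant for traces, without cancellation; the condition on generators excludes
    factors that are merely independent of [v]. *)
Definition commutant v x :=
  teq (x ++ v) (v ++ x) /\ {subset gens x <= gens v}.

(** The ratio of the counts in [x] and [v] agrees for dependent generators, hence is constant on a
    connected support. *)
Lemma commutant_cnt v x s s0 : irreducible v -> commutant v x ->
  s0 \in gens v -> cnt s x * cnt s0 v = cnt s v * cnt s0 x.
Proof.
move=> irr [com sub] s0v.
have [sv|sv] := boolP (s \in gens v); last first.
  have z u : s \notin gens u -> cnt s u = 0 by move/count_memPn.
  by rewrite !z //; apply: contra sv; apply: sub.
pose A s := cnt s x * cnt s0 v == cnt s v * cnt s0 x.
have step l m : l \in v -> m \in v -> A l.1 -> ~~ A m.1 -> ind l.1 m.1.
  move=> lv mv /eqP al; apply: contraNT => /commute_cnt/(_ com) e.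
  have p : 0 < cnt l.1 v by rewrite cnt_gt0 map_f.
  rewrite /A -(eqn_pmul2r p).
  rewrite mulnAC -e -mulnA [cnt m.1 v * cnt s0 v]mulnC mulnA al.
  by rewrite mulnC mulnA mulnAC.
case: (irr A step) => all.
  by case/mapP: sv => l lv ->; apply/eqP; apply: all.
by case/mapP: s0v => l lv e; have := all l lv; rewrite /A -e mulnC eqxx.
Qed.

(** The root is a nonempty trace of the commutant with the fewest occurrences of one generator [s0]
    of [v]. By proportionality its count is minimal for every generator, so it is a prefix of each
    nonempty trace of the commutant and can be stripped off repeatedly. *)
Lemma irreducible_root v : v <> [::] -> irreducible v ->
  exists r, [/\ r <> [::], commutant v r &
    forall x, commutant v x -> exists k, teq x (tpow k r)].
Proof.
move=> v0 irr; have [s0 s0v] : exists s0, s0 \in gens v.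
  by case: v v0 {irr} => // a v _; exists a.1; rewrite mem_head.
have p0 : 0 < cnt s0 v by rewrite cnt_gt0.
have com_v : commutant v v by split.
pose P n := `[< exists2 r, commutant v r & r <> [::] /\ cnt s0 r = n >].
have exP : exists n, P n by exists (cnt s0 v); apply/asboolP; exists v.
case: (ex_minnP exP) => n /asboolP[r cr [r0 rn]] min.
exists r; split => // x.
elim: {x}(size x).+1 {-2}x (ltnSn (size x)) => // m IH x xm cx.
have [->|/eqP x0] := eqVneq x [::]; first by exists 0.
have le : cnt s0 r <= cnt s0 x.
  by rewrite rn; apply: min; apply/asboolP; exists x.
have [y e] : exists y, teq x (r ++ y).
  apply: proj_prefix => s t d.
  (* Where the projection of [v] is empty, the support condition in [commutant] empties those of [x]
     and [r] too. *)
  have [v1|vn] := eqVneq (proj s t v) [::].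
    suff z u : commutant v u -> proj s t u = [::].
      by exists [::]; rewrite !z.
    move=> [_ sub]; apply/eqP; rewrite -[_ == _]negbK -has_filter.
    apply/hasPn => l /(map_f fst)/sub/mapP[l' l'v e]; apply: contra_eqN v1.
    by rewrite e => h; rewrite -has_filter; apply/hasP; exists l'.
  apply: (@seq_commute_prefix _ _ _ (proj s t v)); first exact/eqP.
  - by case: cr => /(_ s t d); rewrite /proj !filter_cat.
  - by case: cx => /(_ s t d); rewrite /proj !filter_cat.
  have cle s' : cnt s' r <= cnt s' x.
    by rewrite -(leq_pmul2r p0) !(@commutant_cnt v _ s' s0) // leq_mul2l le orbT.
  by rewrite !size_proj; case: eqP => _; rewrite ?leq_add.
have [cxv sx] := cx; have [crv sr] := cr.
have cy : commutant v y.
  split.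
    apply: (@teq_catI r); rewrite !catA.
    apply: teq_trans (teq_cat (teq_sym e) (teq_refl v)) _.
    apply: teq_trans cxv _; apply: teq_trans (teq_cat (teq_refl v) e) _.
    by rewrite catA; apply: teq_cat (teq_refl y); apply: teq_sym.
  by move=> s h; apply: sx; rewrite (teq_gens e) gens_cat mem_cat h orbT.
have [|k ek] := IH y _ cy.
  by move: xm; rewrite (teq_size e) size_cat; case: (r) r0 => //= *; lia.
by exists k.+1; rewrite tpowS; apply: teq_trans e _; apply: teq_cat.
Qed.

End Traces.

(** * Normal forms and word length in the Artin group *)

Section Artin.
Variables (G : groupType) (S : set G).
Hypothesis hS : right_angled_artin S.
Local Open Scope group_scope.
Implicit Types (x y z t v w g h : G) (a b : S * bool) (u p q : word S) (s : S).

Definition gen_comm : rel S := fun s t : S => (s != t) && `[< commute (val s) (val t) >].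

Lemma gen_comm_sym : symmetric gen_comm.
Proof.
move=> s t; rewrite /gen_comm eq_sym; congr (_ && _).
by apply/asboolP/asboolP => /commute_sym.
Qed.

Lemma gen_comm_irr : irreflexive gen_comm.
Proof. by move=> s; rewrite /gen_comm eqxx. Qed.

Definition ind := Commutation gen_comm_sym gen_comm_irr.

Local Notation lv := (@letter_val G S).
Local Notation val := (@word_val G S).
Local Notation inv := (@inv_letter S).
Local Notation "u ~ v" := (teq ind u v) (at level 70).
Local Notation len := (wlen S).

Lemma letter_val_inv a : lv (inv a) = (lv a)^-1.
Proof. by case: a => s []; rewrite /letter_val //= invgK. Qed.

Lemma word_val_nil : val [::] = 1. Proof. exact: big_nil. Qed.

Lemma word_val_cons a u : val (a :: u) = lv a * val u.
Proof. exact: big_cons. Qed.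

Lemma word_val_cat u p : val (u ++ p) = val u * val p.
Proof. exact: big_cat. Qed.

Lemma word_val_winv u : val (winv u) = (val u)^-1.
Proof.
elim: u => [|a u IH]; first by rewrite word_val_nil invg1.
rewrite winv_cons word_val_cat !word_val_cons invgM IH letter_val_inv.
by rewrite word_val_nil mulg1.
Qed.

Lemma ind_commute a b : ind a.1 b.1 -> commute (lv a) (lv b).
Proof.
case: a b => s e [t f] /= /andP[_ /asboolP c]; rewrite /letter_val /=.
have {}c : commute (if e then (\val s)^-1 else \val s) (\val t).
  by case: e => //; apply/commute_sym/commuteV/commute_sym.
by case: f => //; apply: commuteV.
Qed.

Lemma starts_val b u : starts ind b u -> val u = lv b * val (rem b u).
Proof.
elim: u => //= c u IH; case: eqP => [-> _|_ /andP[i /IH e]] /=.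
  exact: word_val_cons.
by rewrite !word_val_cons e !mulgA (ind_commute i).
Qed.

Lemma teq_val u p : u ~ p -> val u = val p.
Proof.
elim: u p => [p /teq_nil -> //|a u IH p h].
have k : starts ind a p by rewrite -(teq_starts _ h) /= eqxx.
rewrite word_val_cons (starts_val k); congr (_ * _); apply: IH.
by apply: (@teq_consI _ _ a); apply: teq_trans (starts_rem k).
Qed.

Lemma nf_val u : val (nf ind u) = val u.
Proof.
elim: u => //= a u IH; rewrite word_val_cons -IH /ins; case: ifP => [k|_].
  by rewrite (starts_val k) letter_val_inv mulgA mulgV mul1g.
exact: word_val_cons.
Qed.

Lemma pres_eq_ctx R p u u' q :
  pres_eq R u u' -> pres_eq R (p ++ u ++ q) (p ++ u' ++ q).
Proof.
elim=> {u u'} [u|u v _|u v w _ h1 _|u l v|u r v h].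
- exact: pres_refl.
- exact: pres_sym.
- exact: pres_trans.
- have := @pres_cancel _ R (p ++ u) l (v ++ q).
  by rewrite -!catA.
- have := @pres_relator _ R (p ++ u) r (v ++ q) h.
  by rewrite -!catA.
Qed.

Lemma pres_eq_nf u p : pres_eq (@raag_relators G S) u p -> nf ind u ~ nf ind p.
Proof.
elim=> {u p} [u|u v _|u v w _ h1 _|u l v|u r v [s [t [ne c ->]]]].
- exact: teq_refl.
- exact: teq_sym.
- exact: teq_trans.
- rewrite !nf_cat; apply: teq_foldr_ins => /=.
  by have := @ins_invK _ ind l _ (reduced_nf ind v).
have i : ind s t by apply/andP; split; [apply/eqP|apply/asboolP].
rewrite !nf_cat; apply: teq_foldr_ins => /=.
set z := nf ind v; have rz : reduced ind z by apply: reduced_nf.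
(* Swapping the two middle insertions brings each generator next to its inverse. *)
apply: teq_trans (teq_ins _ (@insC _ ind (t, false) (s, true) _ _)) _.
  by rewrite comm_sym.
apply: teq_trans (@ins_invK _ ind (s, false) _ _) _.
  by do 2!apply: reduced_ins.
exact: (@ins_invK _ ind (t, false)).
Qed.

(** The presentation enters here. It only decides when a word is trivial, so the inverse of [p]
    followed by [p] is inserted behind [u] to compare two words. *)
Lemma nf_uniq u p : val u = val p -> nf ind u ~ nf ind p.
Proof.
move=> e; case: hS => _ _ /(_ (u ++ winv p)).
rewrite word_val_cat word_val_winv e mulgV => -[/(_ erefl) h _].
apply: pres_eq_nf.
apply: pres_trans (_ : pres_eq _ _ (u ++ winv p ++ p)) _; last first.
  by have := pres_eq_ctx [::] p h; rewrite /= -catA.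
apply: pres_sym; rewrite -{2}(cats0 u).
have : pres_eq (@raag_relators G S) (winv p ++ p) [::].
  elim: p {e h} => [|a p IH]; first exact: pres_refl.
  rewrite winv_cons -catA; apply: pres_trans IH.
  by have := @pres_cancel _ (@raag_relators G S) (winv p) (inv a) p; rewrite inv_letterK.
by move=> /(pres_eq_ctx u [::]); rewrite !cats0.
Qed.

(** A chosen reduced word; only its trace is determined by [x]. The default [[::]] is never reached,
    because [S] generates the group. *)
Definition rw x : word S := nf ind (xget [::] [set u | val u = x]).

Lemma rwK x : val (rw x) = x.
Proof.
rewrite nf_val; apply: (@xgetPex _ _ [set u | val u = x]).
by case: hS => _ /(_ x).
Qed.

Lemma reduced_rw x : reduced ind (rw x). Proof. exact: reduced_nf. Qed.

Lemma rwE u x : reduced ind u -> val u = x -> rw x ~ u.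
Proof.
by move=> ru e; rewrite -(nf_reduced ru) -(nf_reduced (reduced_rw x));
   apply: nf_uniq; rewrite rwK.
Qed.

Lemma size_rw_le u x : val u = x -> (size (rw x) <= size u)%N.
Proof.
move=> e; apply: leq_trans (size_nf ind u); rewrite (@teq_size _ ind _ (nf ind u)) //.
by apply: rwE; rewrite ?reduced_nf ?nf_val.
Qed.

Lemma wlenE x : len x = size (rw x).
Proof.
rewrite /wlen; set P := (X in xget _ X).
have [[u e <-] min] : P (xget 0%N P).
  apply: xgetPex; exists (size (rw x)); split; first by exists (rw x); rewrite ?rwK.
  by move=> u; apply: size_rw_le.
by apply/eqP; rewrite eqn_leq (size_rw_le e) andbT min // rwK.
Qed.

Lemma reduced_len u x : val u = x -> (size u <= len x)%N -> reduced ind u.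
Proof.
move=> e le; apply: reduced_size; apply/eqP; rewrite eqn_leq size_nf.
apply: (leq_trans le); rewrite wlenE (@teq_size _ ind _ (nf ind u)) //.
by apply: rwE; rewrite ?reduced_nf ?nf_val.
Qed.

Lemma len_reduced u x : val u = x -> reduced ind u -> len x = size u.
Proof. by move=> e r; rewrite wlenE; apply: teq_size (rwE r e). Qed.

Lemma len_le u x : val u = x -> (len x <= size u)%N.
Proof. by rewrite wlenE; apply: size_rw_le. Qed.

Lemma lenM x y : (len (x * y) <= len x + len y)%N.
Proof.
rewrite (wlenE x) (wlenE y) -size_cat; apply: len_le.
by rewrite word_val_cat !rwK.
Qed.

Lemma len1 : len 1 = 0%N.
Proof. exact: (@len_reduced [::] _ word_val_nil). Qed.

Lemma rw1 : rw 1 = [::].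
Proof. by apply/eqP; rewrite -size_eq0 -wlenE len1. Qed.

Lemma len_eq0 x : len x = 0%N -> x = 1.
Proof. by rewrite wlenE -{2}(rwK x) => /size0nil ->; exact: word_val_nil. Qed.

Lemma lenV x : len x^-1 = len x.
Proof.
suff le z : (len z^-1 <= len z)%N.
  by apply/eqP; rewrite eqn_leq le -{1}[x]invgK le.
rewrite [len z]wlenE -(_ : size (winv (rw z)) = size (rw z)).
  by apply: len_le; rewrite word_val_winv rwK.
by rewrite size_rev size_map.
Qed.

Lemma rwV x : rw x^-1 ~ winv (rw x).
Proof.
have e : val (winv (rw x)) = x^-1 by rewrite word_val_winv rwK.
apply: rwE (e); apply: reduced_len e _.
by rewrite lenV wlenE size_rev size_map.
Qed.

(** * Reduced products *)

(** A product without cancellation, expressed by length so that reassociation is arithmetic with the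
    triangle inequality. *)
Definition rprod x y := len (x * y) == (len x + len y)%N.

Definition first a x := starts ind a (rw x).

Lemma rprodE x y : rprod x y = reduced ind (rw x ++ rw y).
Proof.
have e : val (rw x ++ rw y) = x * y by rewrite word_val_cat !rwK.
apply/eqP/idP => [h|r].
  by apply: reduced_len e _; rewrite h size_cat -!wlenE.
by rewrite (len_reduced e r) size_cat -!wlenE.
Qed.

Lemma rw_prod x y : rprod x y -> rw (x * y) ~ rw x ++ rw y.
Proof. by rewrite rprodE => r; apply: rwE => //; rewrite word_val_cat !rwK. Qed.

(** Cancellation begins at the junction: [first a x^-1] means that the inverse of [a] can be the
    last letter of [x]. *)
Lemma rprodP x y : reflect (forall a, first a x^-1 -> ~~ first a y) (rprod x y).
Proof.
rewrite rprodE; apply: (iffP idP) => [r a|h].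
  by rewrite /first (teq_starts _ (rwV x)); apply: reduced_catN.
apply: reduced_catP; rewrite ?reduced_rw // => b.
by rewrite -(teq_starts _ (rwV x)); apply: h.
Qed.

Lemma first_prod a x y : rprod x y ->
  first a (x * y) = first a x || indw ind a.1 (rw x) && first a y.
Proof. by move=> /rw_prod h; rewrite /first (teq_starts _ h) starts_cat. Qed.

Lemma rw_letter a : rw (lv a) ~ [:: a].
Proof. by apply: rwE => //; rewrite word_val_cons word_val_nil mulg1. Qed.

Lemma len_letter a : len (lv a) = 1%N.
Proof. by rewrite wlenE (teq_size (rw_letter a)). Qed.

Lemma first_letter a b : first b (lv a) = (b == a).
Proof. by rewrite /first (teq_starts _ (rw_letter a)) /= andbF orbF eq_sym. Qed.

Lemma rw_eq u x : u ~ rw x -> x = val u.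
Proof. by move/teq_val => ->; rewrite rwK. Qed.

Lemma rprod_rwP u p x : rw x ~ u ++ p -> rprod (val u) (val p) /\ x = val u * val p.
Proof.
move=> h; have r : reduced ind (u ++ p) by rewrite -(teq_reduced h) reduced_rw.
have [ru rp] := reduced_cat r.
have e : x = val (u ++ p) by apply: rw_eq; apply: teq_sym.
rewrite e word_val_cat; split=> //; apply/eqP.
rewrite -word_val_cat (len_reduced erefl r) size_cat.
by rewrite (len_reduced erefl ru) (len_reduced erefl rp).
Qed.

Lemma firstP a x : reflect (exists2 y, x = lv a * y & rprod (lv a) y) (first a x).
Proof.
apply: (iffP idP) => [h|[y -> r]].
  have := @rprod_rwP [:: a] (rem a (rw x)) x (starts_rem h).
  by rewrite word_val_cons word_val_nil mulg1 => -[r e]; exists (val (rem a (rw x))).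
by rewrite first_prod // first_letter eqxx.
Qed.

Lemma first_exists x : x <> 1 -> exists a, first a x.
Proof.
rewrite -{1}(rwK x) /first; case: (rw x) => [|a u _].
  by rewrite word_val_nil.
by exists a; rewrite /= eqxx.
Qed.

Lemma first_len a y : rprod (lv a) y -> len (lv a * y) = (len y).+1.
Proof. by move/eqP; rewrite len_letter add1n. Qed.

Lemma rprod_assoc x y z :
  rprod x y -> rprod (x * y) z -> rprod y z /\ rprod x (y * z).
Proof.
move=> /eqP e1 /eqP e2.
have := lenM y z; have := lenM x (y * z); have := lenM x y.
rewrite /rprod mulgA e2 e1 => h1 h2 h3.
have e : len (y * z) = (len y + len z)%N by lia.
by rewrite e eqxx addnA.
Qed.

Lemma rprod_assocr x y z :
  rprod y z -> rprod x (y * z) -> rprod x y /\ rprod (x * y) z.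
Proof.
move=> /eqP e1 /eqP e2.
have := lenM x y; have := lenM (x * y) z; have := lenM y z.
rewrite /rprod -mulgA e2 e1 => h1 h2 h3.
have e : len (x * y) = (len x + len y)%N by lia.
by rewrite e eqxx addnA.
Qed.

Lemma rprodV x y : rprod x y = rprod y^-1 x^-1.
Proof. by rewrite /rprod -invgM !lenV addnC. Qed.

Lemma rprod1g y : rprod 1 y. Proof. by rewrite /rprod mul1g len1. Qed.
Lemma rprodg1 y : rprod y 1. Proof. by rewrite /rprod mulg1 len1 addn0. Qed.

Lemma prefixE x y : prefix_le S x y <-> rprod x (x^-1 * y).
Proof. by rewrite /prefix_le /rprod mulVKg eq_sym; split => [->|/eqP]. Qed.

Lemma prefixP x y : prefix_le S x y <-> exists2 z, y = x * z & rprod x z.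
Proof.
rewrite prefixE; split=> [h|[z -> h]]; last by rewrite mulKg.
by exists (x^-1 * y); rewrite ?mulVKg.
Qed.

Lemma prefix_refl x : prefix_le S x x.
Proof. by rewrite prefixE mulVg rprodg1. Qed.

Lemma prefix1 x : prefix_le S 1 x.
Proof. by rewrite prefixE rprod1g. Qed.

Lemma prefix_anti x y : prefix_le S x y -> prefix_le S y x -> x = y.
Proof.
move=> /prefixP[p -> /eqP e1] /prefixP[q e /eqP e2].
have := congr1 len e; rewrite e2 e1 => e3.
by rewrite (@len_eq0 p) ?mulg1 //; lia.
Qed.

Lemma prefix_first a x y : first a x -> prefix_le S x y -> first a y.
Proof. by move=> f /prefixP[z -> r]; rewrite first_prod // f. Qed.

Lemma letter_prefix a x : first a x <-> prefix_le S (lv a) x.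
Proof. by rewrite prefixP; split=> /firstP. Qed.

(** * Independence *)

Definition indep x y := forall l, l \in rw x -> indw ind l.1 (rw y).

Lemma indep_sym x y : indep x y -> indep y x.
Proof.
move=> h l lx; apply/allP => m mx; rewrite comm_sym.
by have /allP := h m mx; apply.
Qed.

Lemma indep1g x : indep 1 x. Proof. by move=> l; rewrite rw1. Qed.

Lemma indep_letter a x : indep (lv a) x <-> indw ind a.1 (rw x).
Proof.
split=> [h|h l]; first by apply: h; rewrite (teq_mem (rw_letter a)) mem_head.
by rewrite (teq_mem (rw_letter a)) inE => /eqP ->.
Qed.

Lemma indep_first a x y : indep x y -> first a x -> indw ind a.1 (rw y).
Proof. by move=> h /starts_mem; apply: h. Qed.

Lemma indw_firstN a x : indw ind a.1 (rw x) -> first a x = false.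
Proof. by move=> i; apply/negP => /startsN; rewrite i. Qed.

Lemma indw_rwV s x : indw ind s (rw x^-1) = indw ind s (rw x).
Proof. by rewrite (teq_indw _ (rwV x)) indw_winv. Qed.

Lemma indep_Vl x y : indep x y -> indep x^-1 y.
Proof. by move=> /indep_sym h; apply: indep_sym => l lx; rewrite indw_rwV; apply: h. Qed.

Lemma indep_Vr x y : indep x y -> indep x y^-1.
Proof. by move=> /indep_sym h; apply: indep_sym; apply: indep_Vl. Qed.

Lemma indep_rprod x y : indep x y -> rprod x y.
Proof.
by move=> h; apply/rprodP => a f; rewrite indw_firstN //; apply: indep_first f; apply: indep_Vl.
Qed.

Lemma indw_prod s x y : rprod x y ->
  indw ind s (rw (x * y)) = indw ind s (rw x) && indw ind s (rw y).
Proof. by move/rw_prod/teq_indw => ->; apply: all_cat. Qed.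

Definition supported (B : pred S) x := all (fun l : S * bool => B l.1) (rw x).

Lemma supported_mul B x y : supported B x -> supported B y -> supported B (x * y).
Proof.
move=> hx hy; set u := rw x ++ rw y.
have iu : all (fun l : S * bool => B l.1) u by rewrite all_cat; apply/andP.
have e : val u = x * y by rewrite word_val_cat !rwK.
have nn : rw (x * y) ~ nf ind u by apply: rwE; rewrite ?reduced_nf ?nf_val.
rewrite /supported (eq_all_r (teq_mem nn)).
elim: (u) iu => //= b p IH /andP[sb /IH hp].
rewrite /ins; case: ifP => _ /=; last by rewrite sb.
by apply/allP => l /mem_rem lm; have /allP := hp; apply.
Qed.

Lemma indw_mul s x y :
  indw ind s (rw x) -> indw ind s (rw y) -> indw ind s (rw (x * y)).
Proof. exact: (@supported_mul (ind s)). Qed.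

Lemma supportedV B x : supported B x -> supported B x^-1.
Proof. by rewrite /supported (eq_all_r (teq_mem (rwV x))) /winv all_rev all_map. Qed.

Lemma supported_prod B x y : rprod x y ->
  supported B (x * y) = supported B x && supported B y.
Proof. by move/rw_prod/teq_mem/eq_all_r => e; rewrite /supported e all_cat. Qed.

Lemma indw_commute a x : indw ind a.1 (rw x) -> commute (lv a) x.
Proof.
rewrite -{2}(rwK x); elim: (rw x) => [_|b u IH /= /andP[i /IH h]].
  by rewrite word_val_nil; apply: commute1.
by rewrite word_val_cons; apply: commuteM => //; apply: ind_commute.
Qed.

Lemma indep_commute x y : indep x y -> commute x y.
Proof.
rewrite /indep -{2}(rwK x); elim: (rw x) => [_|b u IH /= h].
  by rewrite word_val_nil; apply: commute_sym; apply: commute1.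
rewrite word_val_cons; apply/commute_sym/commuteM; apply: commute_sym.
  by apply: indw_commute; apply: h; rewrite mem_head.
by apply: IH => l lu; apply: h; rewrite inE lu orbT.
Qed.

Lemma indep_prodr x y z : rprod y z -> indep x (y * z) <-> indep x y /\ indep x z.
Proof.
move=> r; split=> [h|[h1 h2] l lx]; last by rewrite indw_prod // h1 // h2.
by split=> l /h; rewrite indw_prod // => /andP[].
Qed.

Lemma indep_mulr x y z : indep x y -> indep x z -> indep x (y * z).
Proof. by move=> hy hz l lx; apply: indw_mul; [apply: hy|apply: hz]. Qed.

Lemma indep_prodl x y z : rprod y z -> indep (y * z) x <-> indep y x /\ indep z x.
Proof.
move=> r; split=> [/indep_sym/(indep_prodr _ r)[] |[]] /indep_sym h1 /indep_sym h2.
  by [].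
by apply: indep_sym; apply/indep_prodr.
Qed.

(** * Greatest lower bounds and orthogonality *)

Lemma rprod_prefix g x y : rprod g y -> prefix_le S x y -> rprod g x.
Proof. by move=> r /prefixP[z e rz]; rewrite e in r; have [] := rprod_assocr rz r. Qed.

Lemma prefix_mull g x y : rprod g x -> rprod g y ->
  prefix_le S (g * x) (g * y) <-> prefix_le S x y.
Proof.
move=> /eqP ex /eqP ey; rewrite /prefix_le ex ey invgM -mulgA mulKg.
by rewrite -addnA; split=> [/addnI|->].
Qed.

(** The letter [a] can come first in the product but not in [t], so it comes from the complement of
    [t] and moves past all of [t]. *)
Lemma prefix_indep_letter a x t : rprod (lv a) x -> prefix_le S t (lv a * x) ->
  ~~ first a t -> indw ind a.1 (rw t) /\ prefix_le S t x.
Proof.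
move=> r /prefixP[y e ry] nf.
have : first a (t * y) by rewrite -e first_prod // first_letter eqxx.
rewrite first_prod // (negbTE nf) /= => /andP[it /firstP[y' ey ry']].
split=> //; have c := indw_commute it; rewrite ey in e ry.
have := rprod_assocr ry' ry; rewrite -c => -[_ r2].
have rat : rprod (lv a) t by apply/indep_rprod/indep_letter.
have [r' _] := rprod_assoc rat r2.
by apply/prefixP; exists y' => //; apply: (@mulgI _ (lv a)); rewrite e !mulgA c.
Qed.

(** Common first letters are stripped one by one; when there are none, only 1 lies below both. *)
Lemma glb_exists x y : exists z, is_glb S x y z.
Proof.
elim: {x}(len x) {-2}x y (leqnn (len x)) => [|n IH] x y le.
  have -> : x = 1 by apply: len_eq0; lia.
  by exists 1; split => //; [apply: prefix_refl|apply: prefix1].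
have [[a [/firstP[x' ex rx] /firstP[y' ey ry]]]|no] :=
    pselect (exists a, first a x /\ first a y); last first.
  exists 1; split; [exact: prefix1|exact: prefix1|] => t tx ty.
  have [->|/eqP/first_exists[a fa]] := eqVneq t 1; first exact: prefix_refl.
  by case: no; exists a; split; apply: prefix_first fa _.
subst x y.
have [|g [gx gy gm]] := IH x' y'; first by rewrite first_len in le.
have rg : rprod (lv a) g := rprod_prefix rx gx.
exists (lv a * g); split; try by apply/prefix_mull.
move=> t tx ty; case fa : (first a t).
  case/firstP: fa tx ty => t' -> rt' /prefix_mull h1 /prefix_mull h2.
  by apply/prefix_mull => //; apply: gm; [apply: h1|apply: h2].
(* A lower bound that does not start with [a] commutes with [a] and lies below both stripped
   elements, hence below [g]. *)
have [it tx'] := prefix_indep_letter rx tx (negbT fa).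
have [_ ty'] := prefix_indep_letter ry ty (negbT fa).
have /prefixP[k e rk] := gm _ tx' ty'.
apply/prefixP; exists (lv a * k).
  by rewrite e !mulgA (indw_commute it).
have := first_len rg; rewrite {1}e mulgA (indw_commute it) -mulgA => e1.
have := lenM t (lv a * k); have := lenM (lv a) k; rewrite len_letter.
by move/eqP: rk; rewrite /rprod e1 -e => -> *; apply/eqP; lia.
Qed.

Lemma meet_glb x y : is_glb S x y (meet S x y).
Proof. exact: xgetPex (glb_exists x y). Qed.

Lemma meet1P x y : meet S x y = 1 <-> forall a, first a x -> ~~ first a y.
Proof.
have [mx my mm] := meet_glb x y; split=> [e a fx|h].
  apply/negP => fy; have := mm (lv a); rewrite -!letter_prefix e => /(_ fx fy).
  by rewrite /first rw1.
have [//|/eqP/first_exists[a fa]] := eqVneq (meet S x y) 1.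
by have := h a (prefix_first fa mx); rewrite (prefix_first fa my).
Qed.

Lemma meet_mull g x y : rprod g x -> rprod g y -> meet S x y = 1 ->
  meet S (g * x) (g * y) = g.
Proof.
move=> rx ry m1; have [mx my mm] := meet_glb (g * x) (g * y).
have gx : prefix_le S g (g * x) by apply/prefixP; exists x.
have gy : prefix_le S g (g * y) by apply/prefixP; exists y.
have /prefixP[e em re] := mm g gx gy.
rewrite em in mx my *; suff -> : e = 1 by rewrite mulg1.
have [_ _ /(_ e)] := meet_glb x y; rewrite m1.
move=> /(_ (proj1 (prefix_mull re rx) mx) (proj1 (prefix_mull re ry) my)).
by move=> /prefix_anti -> //; apply: prefix1.
Qed.

Lemma indep_prefix x y z : indep x y -> rprod x z -> prefix_le S y (x * z) ->
  prefix_le S y z.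
Proof.
elim: {x}(len x) {-2}x (leqnn (len x)) => [|n IH] x le.
  by have -> : x = 1 by [apply: len_eq0; lia]; rewrite mul1g.
have [->|/eqP/first_exists[a /firstP[x' e ra]]] := eqVneq x 1.
  by rewrite mul1g.
subst x; rewrite indep_prodl // => -[/indep_letter ia ix] r h.
have [r1 r2] := rprod_assoc ra r.
apply: (IH x') => //; first by rewrite first_len in le.
rewrite -mulgA in h; have [] // := prefix_indep_letter r2 h.
by rewrite indw_firstN.
Qed.

(** A first letter of [x] is not a first letter of [y], so below the common bound [z] it has to
    commute with all of [y]; then it is stripped. *)
Lemma common_upper_indep x y z : meet S x y = 1 ->
  prefix_le S x z -> prefix_le S y z -> indep x y.
Proof.
elim: {x}(len x) {-2}x z (leqnn (len x)) => [|n IH] x z le.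
  by have -> : x = 1 by [apply: len_eq0; lia]; move=> *; apply: indep1g.
have [->|/eqP/first_exists[a /firstP[x' e ra]]] := eqVneq x 1.
  by move=> *; apply: indep1g.
subst x; move=> /meet1P m1 /prefixP[z' -> rz] yz.
have [r1 r2] := rprod_assoc ra rz.
have nfy : ~~ first a y by apply: m1; rewrite first_prod // first_letter eqxx.
rewrite -mulgA in yz; have [iy yz'] := prefix_indep_letter r2 yz nfy.
apply/indep_prodl => //; split; first exact/indep_letter.
apply: (IH x' (x' * z')) => //; first by rewrite first_len in le.
  (* A common first letter [b] of [x'] and [y] would commute with [a] and hence be a first letter of
     [lv a * x']. *)
  apply/meet1P => b fx; apply/negP => fy.
  have bi : indw ind b.1 (rw (lv a)).
    rewrite (teq_indw _ (rw_letter a)) /= andbT gen_comm_sym.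
    exact: (allP iy) (starts_mem fy).
  by have := m1 b; rewrite first_prod // bi fx orbT fy => /(_ isT).
by apply/prefixP; exists z'.
Qed.

Lemma orthogonalP x y : orthogonal S x y <-> indep x y.
Proof.
split=> [[m [z [xz yz _]]]|i]; first exact: common_upper_indep m xz yz.
split.
  apply/meet1P => a fx; apply/negP => fy.
  by rewrite indw_firstN in fy => //; apply: indep_first fx.
have r := indep_rprod i.
exists (x * y); split; first by apply/prefixP; exists y.
  rewrite (indep_commute i); apply/prefixP; exists x => //.
  exact/indep_rprod/indep_sym.
move=> t /prefixP[t' -> rt] yt.
have /prefixP[t2 e r2] := indep_prefix i rt yt.
apply/prefixP; exists t2; first by rewrite e mulgA.
by rewrite e in rt; have [] := rprod_assocr r2 rt.
Qed.

(** * Cyclic reduction *)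

(* Equivalent to cyclically_reduced S v, by meet1P and rprodP. *)
Definition cycred v := rprod v v.

Lemma cycredV v : cycred v^-1 = cycred v.
Proof. by rewrite /cycred -rprodV. Qed.

(** A last letter of [v] does not cancel into the next copy of [v]; to cancel further on, its
    inverse would have to commute with [v], which contains its generator. *)
Lemma rprod_expS v n : cycred v -> rprod v (v ^+ n).
Proof.
move=> c; elim: n => [|n IH]; first by rewrite expg0 rprodg1.
apply/rprodP => a fa; rewrite expgS first_prod //.
have /rprodP/(_ a fa)/negbTE -> /= := c.
apply/negP => /andP[i _].
by move: fa; rewrite indw_firstN // indw_rwV.
Qed.

Lemma len_exp v n : cycred v -> len (v ^+ n) = (n * len v)%N.
Proof.
move=> c; elim: n => [|n IH]; first by rewrite expg0 len1.
by rewrite expgS; have /eqP -> := rprod_expS n c; rewrite IH mulSn.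
Qed.

Lemma rw_exp v n : cycred v -> rw (v ^+ n) ~ tpow n (rw v).
Proof.
move=> c; elim: n => [|n IH]; first by rewrite expg0 rw1; apply: teq_refl.
rewrite expgS tpowS; apply: teq_trans (rw_prod (rprod_expS n c)) _.
by apply: teq_cat => //; apply: teq_refl.
Qed.

Lemma indw_expS s v n : cycred v -> indw ind s (rw (v ^+ n.+1)) = indw ind s (rw v).
Proof.
move=> c; rewrite expgS indw_prod ?rprod_expS //; apply/andb_idr => h.
elim: n => [|n IH]; first by rewrite expg0 rw1.
by rewrite expgS indw_mul.
Qed.

Definition cyclic_form x d v :=
  [/\ cycred v, x = d * v * d^-1 & len x = (len d + len v + len d)%N].

Lemma cyclic_form_exists x : exists d v, cyclic_form x d v.
Proof.
elim: {x}(len x).+1 {-2}x (ltnSn (len x)) => // n IH x le.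
have [c|/rprodP] := boolP (cycred x).
  by exists 1, x; split => //; rewrite ?len1 ?invg1 ?mul1g ?mulg1 ?addn0.
move=> /existsNP[a /not_implyP[f1 /negP/negPn /firstP[y e ry]]].
(* [x] starts with [a] and ends with its inverse; these are different letters, so the inverse still
   ends [y]. *)
have : first a y^-1.
  move: f1; rewrite e invgM first_prod -?rprodV // -letter_val_inv first_letter.
  by case: eqP => [h|_]; rewrite ?andbF ?orbF //; have := inv_letter_neq a; rewrite -h eqxx.
move=> /firstP[z ez rz].
have lx : len x = (len z).+2 by rewrite e first_len // -lenV ez first_len.
have [|d [v [c ez' lz]]] := IH z^-1; first by rewrite lenV; lia.
have ex : x = lv a * z^-1 * (lv a)^-1 by rewrite e -[y]invgK ez invgM !mulgA.
exists (lv a * d), v; split => //; first by rewrite ex ez' invgM !mulgA.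
have e1 : x = lv a * d * v * (lv a * d)^-1 by rewrite ex ez' invgM !mulgA.
rewrite lenV in lz.
have := lenM (lv a) d; have := lenM (lv a * d) v.
have := lenM (lv a * d * v) (lv a * d)^-1; rewrite -e1 lenV len_letter.
by move=> *; lia.
Qed.

Section CyclicForm.
Variables (x d v : G).
Hypothesis form : cyclic_form x d v.

Let cv : cycred v. Proof. by case: form. Qed.

Lemma cyclic_form_rprod : [/\ rprod d v, rprod v d^-1 & rprod d (v * d^-1)].
Proof.
have [_ e l] := form.
have := lenM (d * v) d^-1; have := lenM d v; have := lenM v d^-1.
have := lenM d (v * d^-1).
rewrite mulgA -e lenV => h1 h2 h3 h4.
by split; apply/eqP; rewrite ?mulgA -?e ?lenV; lia.
Qed.

(** A last letter of [d] commuting with [v] would cancel against its inverse in [d^-1],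
    contradicting the length equation. *)
Lemma cyclic_form_indw a : first a d^-1 -> ~~ indw ind a.1 (rw v).
Proof.
move=> /firstP[e ed re]; apply/negP => i.
have [_ ex l] := form.
have ld : len d = (len e).+1 by rewrite -lenV ed first_len.
have ex' : x = e^-1 * v * e.
  rewrite ex -[d in d * v]invgK ed invgM !mulgA -[_ * (lv a)^-1 * v]mulgA.
  by rewrite -(commuteV (commute_sym (indw_commute i))) !mulgA mulgVK.
have := lenM (e^-1 * v) e; rewrite -ex'.
move=> /leq_trans/(_ (leq_add (lenM e^-1 v) (leqnn _))).
by rewrite lenV; lia.
Qed.

Lemma cyclic_form_exp n :
  [/\ x ^+ n.+1 = d * (v ^+ n.+1 * d^-1), rprod (v ^+ n.+1) d^-1 &
      rprod d (v ^+ n.+1 * d^-1)].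
Proof.
have [rdv rvd _] := cyclic_form_rprod; have [_ ex _] := form.
have r1 : rprod (v ^+ n.+1) d^-1.
  have cv' : cycred v^-1 by rewrite cycredV.
  apply/rprodP => a; rewrite -expVgn expgS first_prod ?rprod_expS //.
  move=> /orP[|/andP[i _]]; first by move/rprodP: rvd; apply.
  by apply/negP => /cyclic_form_indw; rewrite -indw_rwV i.
have ind_v a : first a d^-1 -> ~~ first a (v ^+ n.+1).
  move=> fa; rewrite expgS first_prod ?rprod_expS // negb_or.
  move/rprodP: rdv => /(_ a fa) -> /=.
  by rewrite (negbTE (cyclic_form_indw fa)).
split => //; last first.
  apply/rprodP => a fa; rewrite first_prod // negb_or ind_v //=.
  by rewrite indw_expS // (negbTE (cyclic_form_indw fa)).
rewrite ex mulgA; elim: n {r1 ind_v} => // n IH.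
by rewrite expgS IH [v ^+ n.+2]expgS !mulgA mulgVK.
Qed.

Lemma cyclic_formV : cyclic_form x^-1 d v^-1.
Proof.
have [c e l] := form; split; first by rewrite cycredV.
  by rewrite e !invgM invgK mulgA.
by rewrite !lenV.
Qed.

End CyclicForm.

(** If the conjugating part [d] were nontrivial, its first letter would start all positive powers of
    both [x] and [x^-1]. *)
Lemma cycred_of_exp x n : (0 < n)%N -> cycred (x ^+ n) -> cycred x.
Proof.
case: n => // n _ c; have [d [v f]] := cyclic_form_exists x.
have [d1|/eqP/first_exists[a fa]] := eqVneq d 1.
  by have [cv -> _] := f; rewrite d1 invg1 mul1g mulg1.
have [e _ r] := cyclic_form_exp f n.
have [e' _ r'] := cyclic_form_exp (cyclic_formV f) n.
move/rprodP: c => /(_ a); rewrite -expVgn e' e (first_prod _ r') (first_prod _ r) fa.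
by move=> /(_ isT).
Qed.

Lemma phiE w x : phi S w x =
  x * (x^-1 * w * x) * meet S (x^-1 * w * x)^-1 ((x^-1 * w * x)^-1 * (x^-1 * w * x)^-1).
Proof.
rewrite /phi /median; congr (_ * meet S _ _); rewrite ?invgM ?invgK ?mulgA.
- by rewrite mulgV mul1g.
- by rewrite ?mulgA.
by rewrite mulgK.
Qed.

(** If [d * v * d^-1] is the cyclic form of [x^-1 * w * x], then [phi S w x] is [x * d], which
    conjugates [w] to the core [v]. Conversely a point with cyclically reduced conjugate is fixed by
    [phi S w]. *)
Lemma axisP w (a : G) : axis S w a <-> cycred (a^-1 * w * a).
Proof.
split=> [[x _ <-]|c]; last first.
  exists a => //; rewrite phiE; set v := a^-1 * w * a.
  have cv : cycred v^-1 by rewrite cycredV.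
  have := @meet_mull v^-1 1 v^-1 (rprodg1 _) cv; rewrite mulg1 => ->.
    by rewrite mulgK.
  by apply/meet1P => b; rewrite /first rw1.
rewrite phiE; set u := x^-1 * w * x; have [d [v f]] := cyclic_form_exists u.
have f' := cyclic_formV f.
have [e _ _] := cyclic_form_exp f' 0; rewrite !expg1 in e.
have [e2 r2 r2'] := cyclic_form_exp f' 1; rewrite !expg2 in e2 r2 r2'.
have [cv eu lu] := f.
have [r1 r1' r1''] := cyclic_form_rprod f'.
(* Behind the common prefix [d * v^-1], the remainders [d^-1] and [v^-1 * d^-1] share no first
   letter, because [d] times the latter is reduced. *)
have -> : meet S u^-1 (u^-1 * u^-1) = d * v^-1.
  rewrite e2 e mulgA -[v^-1 * v^-1 * _]mulgA [d * (v^-1 * _)]mulgA.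
  apply: meet_mull.
  - by have [] := rprod_assocr r1' r1''.
  - have cv' : rprod v^-1 v^-1 by rewrite -/(cycred _) cycredV.
    rewrite -mulgA in r2'.
    have [_ h] := rprod_assoc cv' r2.
    by have [] := rprod_assocr h r2'.
  by apply/meet1P; apply/rprodP.
rewrite eu.
have -> : x * (d * v * d^-1) * (d * v^-1) = x * d.
  by rewrite !mulgA mulgVK mulgK.
by rewrite invgM -!mulgA [w * _]mulgA [x^-1 * _]mulgA [x^-1 * _]mulgA -/u eu !mulgA mulVg mul1g mulgVK.
Qed.

(** * Conjugation of cyclically reduced elements *)

(** Otherwise [g^-1 * v * g] would be reduced as written, likewise with [v^-1], and [v ^ g] and its
    inverse would share a first letter of [g^-1]. *)
Lemma cycred_conj_first v g : cycred v -> cycred (v ^ g) -> g <> 1 ->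
  exists2 a, first a g & [|| first a v, first a v^-1 | indw ind a.1 (rw v)].
Proof.
move=> cv cy g1; apply: contrapT => none.
have no a : first a g -> [/\ first a v = false, first a v^-1 = false &
    indw ind a.1 (rw v) = false].
  move=> fa; have /negP : ~ [|| first a v, first a v^-1 | indw ind a.1 (rw v)].
    by move=> h; apply: none; exists a.
  by rewrite !negb_or => /and3P[/negbTE-> /negbTE-> /negbTE->].
have fin z b : (forall a, first a g -> [/\ first a z = false, first a z^-1 = false &
    indw ind a.1 (rw z) = false]) -> first b g^-1 -> first b (z ^ g).
  move=> noz fb.
  have r1 : rprod z g.
    by apply/rprodP => a fz; apply/negP => /noz[_]; rewrite fz.
  have r2 : rprod g^-1 (z * g).
    apply/rprodP => a; rewrite invgK => fa; rewrite first_prod // fa andbT.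
    by have [-> _ ->] := noz a fa.
  by rewrite /conjg first_prod // fb.
have /first_exists[b fb] : g^-1 <> 1.
  by move=> /(congr1 (@monoid.inv G)); rewrite invgK invg1.
have f1 := fin v b no fb.
have f2 : first b (v ^ g)^-1.
  rewrite -conjVg; apply: fin fb => a /no[h1 h2 h3].
  by rewrite invgK indw_rwV.
by move/rprodP: cy => /(_ b f2); rewrite f1.
Qed.

(** The cube of [lv a * x] contains the square of [x * lv a], which is therefore reduced. *)
Lemma cycred_rotate a v : cycred v -> first a v ->
  cycred (v ^ lv a) /\ forall s, indw ind s (rw v) -> indw ind s (rw (v ^ lv a)).
Proof.
move=> c /firstP[x e r]; subst v.
have -> : (lv a * x) ^ lv a = x * lv a by rewrite /conjg -mulgA mulKg.
split=> [|s]; last by rewrite indw_prod // => /andP[ia ix]; apply: indw_mul.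
have [r1 r2] := rprod_assoc r c; have [r3 r4] := rprod_assocr r r1.
have e3 : (lv a * x) ^+ 3 = lv a * ((x * lv a) * (x * lv a) * x).
  by rewrite !expgS expg0 mulg1 !mulgA.
have := len_exp 3 c; rewrite e3 (eqP r) => e4.
have h1 := lenM (lv a) (x * lv a * (x * lv a) * x).
have h2 := lenM (x * lv a * (x * lv a)) x.
have h3 := lenM (x * lv a) (x * lv a).
rewrite /cycred /rprod; rewrite (eqP r3) in h3 *.
rewrite len_letter in e4 h1 h3 *.
by apply/eqP; lia.
Qed.

Lemma cycred_conj_letter a v : cycred v ->
  [|| first a v, first a v^-1 | indw ind a.1 (rw v)] ->
  cycred (v ^ lv a) /\ forall s, indw ind s (rw v) -> indw ind s (rw (v ^ lv a)).
Proof.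
move=> c /or3P[f|f|/indw_commute i]; first exact: cycred_rotate.
  have [|h1 h2] := cycred_rotate _ f; first by rewrite cycredV.
  rewrite conjVg cycredV in h1 *; split=> // s; rewrite -indw_rwV => /h2.
  by rewrite conjVg indw_rwV.
suff -> : v ^ lv a = v by [].
by rewrite /conjg -i mulKg.
Qed.

(** Induction along the letters of [g]: each step rotates [v], rotates [v^-1] or fixes [v], and the
    element stays cyclically reduced. *)
Lemma cycred_conj_ind (P : G -> G -> Prop) :
  (forall v, cycred v -> P v 1) ->
  (forall v a g, cycred v -> [|| first a v, first a v^-1 | indw ind a.1 (rw v)] ->
     P (v ^ lv a) g -> P v (lv a * g)) ->
  forall v g, cycred v -> cycred (v ^ g) -> P v g.
Proof.
move=> P1 PS v g; elim: {g}(len g).+1 {-2}g v (ltnSn (len g)) => // n IH g v le cv cg.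
have [->|/eqP g1] := eqVneq g 1; first exact: P1.
have [a /firstP[h e r] fa] := cycred_conj_first cv cg g1.
rewrite e in le cg *; apply: PS => //; apply: IH.
- by rewrite first_len in le.
- by have [] := cycred_conj_letter cv fa.
by rewrite -conjgM.
Qed.

Lemma indep_cycredl x y : indep x y -> cycred (x * y) -> cycred x.
Proof.
move=> i /rprodP c; have r := indep_rprod i.
apply/rprodP => a fa; apply/negP => fx; have := c a.
rewrite first_prod // fx (indep_commute i) invgM first_prod ?fa; last first.
  by apply/indep_rprod/indep_Vl/indep_Vr.
by move=> /(_ isT).
Qed.

Lemma indep_subr x y z : (forall s, indw ind s (rw y) -> indw ind s (rw z)) ->
  indep x y -> indep x z.
Proof. by move=> h i l /i/h. Qed.

Lemma indep_subl x y z : (forall s, indw ind s (rw y) -> indw ind s (rw z)) ->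
  indep y x -> indep z x.
Proof. by move=> h /indep_sym/(indep_subr h)/indep_sym. Qed.

(* Conjugating one cyclically reduced element into another only permutes
   cyclically the letters of each of its orthogonal factors. *)
Lemma cycred_conj_factor v g : cycred v -> cycred (v ^ g) ->
  forall x y, v = x * y -> indep x y ->
  cycred (x ^ g) /\ forall s, indw ind s (rw x) -> indw ind s (rw (x ^ g)).
Proof.
move: v g; apply: cycred_conj_ind => [v c x y e i|v a g c fa IH x y e i].
  by rewrite conjg1; split => //; apply: indep_cycredl i _; rewrite -e.
have r := indep_rprod i; have ixV := indep_Vr (indep_Vl i); have rV := indep_rprod ixV.
have cx : cycred x by apply: indep_cycredl i _; rewrite -e.
have cy : cycred y.
  by apply: indep_cycredl (indep_sym i) _; rewrite -(indep_commute i) -e.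
have fV : first a v^-1 = first a x^-1 || indw ind a.1 (rw x) && first a y^-1.
  by rewrite e (indep_commute i) invgM first_prod // indw_rwV.
(* A letter that rotates one factor commutes with the other, so the step is admissible for both. *)
have [fx fy] : [|| first a x, first a x^-1 | indw ind a.1 (rw x)] /\
    [|| first a y, first a y^-1 | indw ind a.1 (rw y)].
  have ix b : first b x -> indw ind b.1 (rw y) by apply: indep_first.
  have ixv b : first b x^-1 -> indw ind b.1 (rw y).
    by apply: indep_first; apply: indep_Vl.
  move: fa; rewrite fV e first_prod // indw_prod //.
  move=> /or3P[/orP[f|/andP[-> ->]]|/orP[f|/andP[-> ->]]|/andP[-> ->]];
    by rewrite ?f ?(ix _ f) ?(ixv _ f) ?orbT.
have [_ sx] := cycred_conj_letter cx fx; have [_ sy] := cycred_conj_letter cy fy.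
have [||c' s'] := IH (x ^ lv a) (y ^ lv a); first by rewrite e conjMg.
  by apply: indep_subl sx _; apply: indep_subr sy _.
rewrite conjgM; split => // s h; exact/s'/sx.
Qed.

(** * Convex closures of cyclic groups *)

Lemma zpowers_mul v x y : zpowers v x -> zpowers v y -> zpowers v (x * y).
Proof.
have pm m n : zpowers v (v ^+ m * v ^- n).
  have [le|/ltnW le] := leqP n m; first by exists (m - n)%N; left; rewrite expgnFr.
  by exists (n - m)%N; right; rewrite expgnFr // invgM invgK.
have cvn m n : v ^- m * v ^+ n = v ^+ n * v ^- m.
  by apply/commute_sym/commuteV/commuteX2/commute_refl.
move=> [m [->|->]] [n [->|->]].
- by exists (m + n)%N; left; rewrite expgnDr.
- exact: pm.
- by rewrite cvn.
by exists (n + m)%N; right; rewrite expgnDr invgM.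
Qed.

Lemma zpowersV v x : zpowers v x -> zpowers v x^-1.
Proof. by move=> [n [->|->]]; exists n; [right|left; rewrite invgK]. Qed.

Lemma zpowers_id v : zpowers v v.
Proof. by exists 1%N; left; rewrite expg1. Qed.

Lemma zpowers_exp v n : zpowers v (v ^+ n).
Proof. by exists n; left. Qed.

Lemma zpowers_invE v : zpowers v^-1 = zpowers v.
Proof.
apply/seteqP; split=> x [n [->|->]]; exists n; rewrite ?expVgn ?invgK; auto.
Qed.

Lemma zpowers_conj v g x : zpowers v x -> zpowers (v ^ g) (x ^ g).
Proof. by move=> [n [->|->]]; exists n; rewrite ?conjVg conjXg; auto. Qed.

Lemma zpowers_commute v x : zpowers v x -> commute x v.
Proof.
by move=> [n [->|->]]; apply: commute_sym; [|apply: commuteV];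
   apply: commuteX; apply: commute_refl.
Qed.

Lemma convex_translate g (A : set G) :
  convex S A -> convex S [set x | A (g * x)].
Proof.
move=> cA x y /= Ax Ay z; rewrite /interval /= => h.
by apply: (cA _ _ Ax Ay); rewrite /interval /= !invgM -!mulgA !mulKg.
Qed.

Lemma convex_axis1 v : convex S (axis1 S v).
Proof.
move=> x y hx hy z hz A /= [cA sA]; apply: (cA x y) => //; first exact: hx.
exact: hy.
Qed.

Lemma zpowers_axis1 v x : zpowers v x -> axis1 S v x.
Proof. by move=> h A /= [_]; apply. Qed.

Lemma axis1_between v x y z : axis1 S v x -> axis1 S v (x * y) ->
  prefix_le S z y -> axis1 S v (x * z).
Proof.
by move=> hx hy h; apply: (convex_axis1 hx hy); rewrite /interval /= !mulKg.
Qed.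

Lemma axis1_mul v z x : zpowers v z -> axis1 S v x -> axis1 S v (z * x).
Proof.
move=> hz; apply: (@smallest_sub _ _ _ [set x | axis1 S v (z * x)]).
  exact: convex_translate (@convex_axis1 v).
by move=> y hy; apply: zpowers_axis1; apply: zpowers_mul.
Qed.

Lemma zpowers_axis_group v : (zpowers v `<=` axis_group S v)%classic.
Proof. by move=> x h; split; [apply: zpowers_commute|apply: zpowers_axis1]. Qed.

Lemma axis_group_inv v : axis_group S v^-1 = axis_group S v.
Proof.
rewrite /axis_group /axis1 zpowers_invE; congr (_ `&` _)%classic.
apply/seteqP; split=> x /= h; last exact: commuteV.
by rewrite -[v]invgK; apply: commuteV.
Qed.

(** As [lv a] is a prefix of [v], its product with a power of the rotated element lies between two
    consecutive powers of [v]. *)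
Lemma axis1_rotate a v x : cycred v -> first a v ->
  axis1 S (v ^ lv a) x -> axis1 S v (lv a * x).
Proof.
move=> c fa; apply: (@smallest_sub _ _ _ [set x | axis1 S v (lv a * x)]).
  exact: convex_translate (@convex_axis1 v).
move=> y /= hy.
have hz : zpowers v (y ^ (lv a)^-1).
  by rewrite -(conjgK (lv a) v); apply: zpowers_conj.
have -> : lv a * y = y ^ (lv a)^-1 * lv a by rewrite /conjg invgK !mulgA mulgVK.
apply: (@axis1_between _ _ v); first exact: zpowers_axis1.
  exact: zpowers_axis1 (zpowers_mul hz (zpowers_id v)).
exact/letter_prefix.
Qed.

Definition axis_cyclic v := axis_group S v = zpowers v.

Lemma axis_cyclic_rotate a v : cycred v -> first a v ->
  axis_cyclic v -> axis_cyclic (v ^ lv a).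
Proof.
move=> c fa av; apply/seteqP; split; last exact: zpowers_axis_group.
move=> h [/= ch hx]; set y := v ^ lv a in ch hx *.
have cK z : lv a * z * (lv a)^-1 = z ^ (lv a)^-1 by rewrite /conjg invgK mulgA.
suff : axis_group S v (h ^ (lv a)^-1).
  rewrite av => /(@zpowers_conj _ (lv a)).
  by rewrite conjgKV.
split=> /=.
  suff : commute (h ^ (lv a)^-1) (y ^ (lv a)^-1) by rewrite conjgK.
  by rewrite /commute -!conjMg ch.
(* The element [lv a * h * (lv a)^-1] lies between [lv a * h] and [lv a * h * y^-1], since [y] ends
   with [a]. *)
rewrite -cK; apply: (@axis1_between _ _ y^-1); first exact: axis1_rotate.
  rewrite -mulgA; apply: axis1_rotate => //; rewrite -/y.
  rewrite (_ : h * y^-1 = y^-1 * h); last exact: commuteV.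
  by apply: axis1_mul => //; apply/zpowersV/zpowers_id.
case/firstP: fa => x e r.
have ey : y = x * lv a by rewrite /y e /conjg -mulgA mulKg.
have /eqP r' : rprod x (lv a).
  rewrite e in c; have [r1 r2] := rprod_assoc r c.
  by have [] := rprod_assocr r r1.
apply/prefixP; exists x^-1; first by rewrite ey invgM.
by rewrite -rprodV; apply/eqP.
Qed.

(** This makes primitivity independent of the point of the axis at which it is tested. *)
Lemma axis_cyclic_conj v g : cycred v -> cycred (v ^ g) ->
  axis_cyclic v -> axis_cyclic (v ^ g).
Proof.
move: v g; apply: cycred_conj_ind => [v|v a g c /or3P fa IH av].
  by rewrite conjg1.
rewrite conjgM; apply: IH.
have axisV z : axis_cyclic z -> axis_cyclic z^-1.
  by rewrite /axis_cyclic axis_group_inv zpowers_invE.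
case: fa => [f|f|/indw_commute i]; first exact: axis_cyclic_rotate.
  rewrite -[v]invgK conjVg; have av' := axisV _ av.
  apply: axisV; apply: axis_cyclic_rotate => //.
  by rewrite cycredV.
by rewrite /conjg -i mulKg.
Qed.

(** * Roots *)

Lemma convex_supported (B : pred S) : convex S [set x | supported B x].
Proof.
move=> x y /= hx hy z /prefixP[t e r].
have : supported B (x^-1 * y) by apply: supported_mul => //; apply: supportedV.
rewrite e supported_prod // => /andP[h _].
by rewrite -(mulVKg x z); apply: supported_mul.
Qed.

Lemma supported_exp (B : pred S) x n : supported B x -> supported B (x ^+ n).
Proof.
by move=> h; elim: n => [|n IH]; rewrite ?expg0 ?expgS ?supported_mul // /supported rw1.
Qed.

Lemma axis1_supported (B : pred S) v x : supported B v -> axis1 S v x -> supported B x.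
Proof.
move=> h; apply: (@smallest_sub _ _ _ [set x | supported B x]).
  exact: convex_supported.
by move=> y [n [->|->]] /=; rewrite ?supportedV ?supported_exp.
Qed.

Lemma supported_gens x : supported (mem (gens (rw x))) x.
Proof. by apply/allP => l lx; apply: map_f. Qed.

Lemma gens_supported (B : pred S) x : supported B x -> {subset gens (rw x) <= B}.
Proof. by move=> /allP h s /mapP[l lx ->]; apply: h. Qed.

Lemma gens_mem l x : l \in rw x -> l.1 \in gens (rw x).
Proof. exact: map_f. Qed.

Lemma indepP x y :
  indep x y <-> forall s s', s \in gens (rw x) -> s' \in gens (rw y) -> ind s s'.
Proof.
split=> [h s s' /mapP[l lx ->] /mapP[m my ->]|h l lx]; first exact: (allP (h l lx)).
by apply/allP => m my; apply: h; apply: gens_mem.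
Qed.

(* The defect of v^N h from being a reduced product is nondecreasing in N and
   bounded by 2 len h. *)
Lemma exp_mul_reduced v h : cycred v -> exists N, rprod v (v ^+ N * h).
Proof.
move=> c; apply: contrapT => none.
have lt N : (len (v ^+ N.+1 * h) < len v + len (v ^+ N * h))%N.
  have := lenM v (v ^+ N * h); rewrite mulgA -expgS leq_eqVlt => /orP[e|//].
  by case: none; exists N; rewrite /rprod mulgA -expgS.
have le N : (len (v ^+ N * h) + N <= len h + N * len v)%N.
  elim: N => [|N IH]; first by rewrite expg0 mul1g; lia.
  by have := lt N; rewrite mulSn; lia.
pose N := (len h + len h).+1.
have := lenM (v ^+ N * h) h^-1; rewrite mulgK len_exp // lenV.
by have := le N; rewrite /N; lia.
Qed.

(** Once a large power of [v] makes the product reduced, commutation in the group becomes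
    commutation of traces; the convex closure stays within the support of [v]. *)
Lemma axis_group_commutant v h : cycred v -> axis_group S v h ->
  exists N, commutant ind (rw v) (rw (v ^+ N * h)).
Proof.
move=> c [/= ch ah]; have [N r] := exp_mul_reduced h c; exists N.
set x := v ^+ N * h in r *.
have cx : commute v x.
  by apply: commuteM; [apply: commuteX|apply: commute_sym].
have r' : rprod x v by rewrite /rprod -cx addnC.
split.
  by apply: teq_trans (teq_sym (rw_prod r')) _; rewrite -cx; apply: rw_prod.
apply: gens_supported; apply: supported_mul.
  exact/supported_exp/supported_gens.
exact: axis1_supported (supported_gens v) ah.
Qed.

Lemma rw_neq0 x : x <> 1 -> rw x <> [::].
Proof. by move=> h e; apply: h; rewrite -(rwK x) e word_val_nil. Qed.

Lemma len_gt0 x : x <> 1 -> (0 < len x)%N.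
Proof. by move=> h; rewrite lt0n; apply/eqP => /len_eq0. Qed.

Lemma irreducible_primitive_root v : cycred v -> v <> 1 -> irreducible ind (rw v) ->
  exists r k, [/\ v = r ^+ k.+1, cycred r, r <> 1 & axis_cyclic r].
Proof.
move=> c v1 irr; have [r0 [r00 [com sub] root]] := irreducible_root (rw_neq0 v1) irr.
have [k ek] : exists k, rw v ~ tpow k r0 by apply: root; split.
case: k ek => [/teq_sym/teq_nil/(rw_neq0 v1)[]|k ek].
have rr : reduced ind r0.
  have : reduced ind (tpow k.+1 r0) by rewrite -(teq_reduced ek) reduced_rw.
  by move=> /reduced_cat[].
pose r := val r0; have er : rw r ~ r0 by apply: rwE.
have tv n : val (tpow n r0) = r ^+ n.
  elim: n => [|n IH]; first by rewrite word_val_nil.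
  by rewrite tpowS word_val_cat IH expgS.
have ev : v = r ^+ k.+1 by rewrite -tv -(teq_val ek) rwK.
have cr : cycred r by apply: (@cycred_of_exp _ k.+1) => //; rewrite -ev.
exists r, k; split=> //.
  by move=> r1; move: er; rewrite r1 rw1 => /teq_nil.
apply/seteqP; split; last exact: zpowers_axis_group.
move=> h /(axis_group_commutant cr)[N [cx sx]].
have [j ej] : exists j, rw (r ^+ N * h) ~ tpow j r0.
  apply: root; split; last by move=> s /sx; rewrite (teq_gens er); apply: sub.
  (* The root property concerns traces commuting with [v]; since [v] is a power of [r0], commuting
     with [r0] suffices. *)
  have cpow n : rw (r ^+ N * h) ++ tpow n r0 ~ tpow n r0 ++ rw (r ^+ N * h).
    elim: n => [|n IH]; first by rewrite cats0; apply: teq_refl.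
    have cx' : rw (r ^+ N * h) ++ r0 ~ r0 ++ rw (r ^+ N * h).
      have := teq_trans (teq_cat (teq_refl _) (teq_sym er)) cx.
      by move/teq_trans; apply; apply: teq_cat (teq_refl _).
    rewrite tpowS -[(r0 ++ _) ++ _]catA; apply: teq_trans (teq_cat (teq_refl r0) IH).
    by rewrite !catA; apply: teq_cat (teq_refl _).
  apply: teq_trans (teq_cat (teq_refl _) ek) _; apply: teq_trans (cpow _) _.
  exact: teq_cat (teq_sym ek) (teq_refl _).
have eh : h = r ^- N * r ^+ j by rewrite -(tv j) -(teq_val ej) rwK mulKg.
rewrite eh; apply: zpowers_mul; last exact: zpowers_exp.
exact/zpowersV/zpowers_exp.
Qed.

Lemma split_indep (B : pred S) v :
  (forall l m, l \in rw v -> m \in rw v -> B l.1 -> ~~ B m.1 -> ind l.1 m.1) ->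
  exists x y, [/\ v = x * y, indep x y, rw x ~ res B (rw v) & rw y ~ res (predC B) (rw v)].
Proof.
move=> h; have hs := res_split h; have [r e] := rprod_rwP hs.
have : reduced ind (res B (rw v) ++ res (predC B) (rw v)).
  by rewrite -(teq_reduced hs) reduced_rw.
move=> /reduced_cat[r1 r2].
exists (val (res B (rw v))), (val (res (predC B) (rw v))).
have e1 := rwE r1 erefl; have e2 := rwE r2 erefl.
split=> // l; rewrite (teq_mem e1) mem_filter => /andP[Bl lv].
apply/allP => m; rewrite (teq_mem e2) mem_filter => /andP[Bm mv].
exact: h.
Qed.

Lemma zpowers_len v x : cycred v -> zpowers v x -> exists n, len x = (n * len v)%N.
Proof. by move=> c [n [->|->]]; exists n; rewrite ?lenV len_exp. Qed.

Lemma prefix_axis_group v x y : v = x * y -> rprod x y -> commute x v ->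
  axis_group S v x.
Proof.
move=> e r cx; split=> //=.
rewrite -(mul1g x); apply: (@axis1_between _ _ v).
- by apply: zpowers_axis1; exists 0%N; left; rewrite expg0.
- by rewrite mul1g; exact: zpowers_axis1 (zpowers_id v).
by apply/prefixP; exists y.
Qed.

(** A splitting puts the factor [x] into the axis group, so its length is a multiple of that of [v],
    and one of the two factors is trivial. *)
Lemma axis_cyclic_irreducible v : cycred v -> v <> 1 -> axis_cyclic v ->
  irreducible ind (rw v).
Proof.
move=> c v1 av B h; have [x [y [e i ex ey]]] := split_indep h.
have r := indep_rprod i.
have : axis_group S v x.
  apply: prefix_axis_group (e) r _; rewrite e; apply: commuteM.
    exact: commute_refl.
  exact: indep_commute.
rewrite av => /(zpowers_len c)[n en].
have l : len v = (len x + len y)%N by rewrite e; apply/eqP.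
have nil z (C : pred S) : rw z ~ res C (rw v) -> len z = 0%N ->
    forall l, l \in rw v -> ~~ C l.1.
  move=> ez /len_eq0 z1 m mv; apply/negP => Cm.
  have : m \in rw z by rewrite (teq_mem ez) mem_filter Cm.
  by rewrite z1 rw1.
case: n en => [|n] en; [right|left].
  by apply: (nil x) => //; lia.
move=> m mv; apply/negPn; apply: (nil y (predC B)) => //.
by have := leq_addr (n * len v) (len v); rewrite -mulSn -en; lia.
Qed.

(** * Orthogonal decompositions *)

Definition indepb (x y : G * nat) := `[< indep x.1 y.1 >].

(** Exponents are stored diminished by one, so that they are positive by construction. *)
Definition factor_prod (L : seq (G * nat)) := \prod_(f <- L) f.1 ^+ f.2.+1.

(** Either [v] is a power of its primitive root or it splits and both halves are decomposed. The
    clause on [indw] lets independence of the halves pass to their factors. *)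
Lemma cycred_decomposition v : cycred v ->
  exists L : seq (G * nat), [/\ v = factor_prod L, pairwise indepb L &
    forall f, f \in L -> [/\ cycred f.1, f.1 <> 1, axis_cyclic f.1 &
      forall s, indw ind s (rw v) -> indw ind s (rw f.1)]].
Proof.
elim: {v}(len v).+1 {-2}v (ltnSn (len v)) => // n IH v le c.
have [->|/eqP v1] := eqVneq v 1.
  by exists [::]; split => //; rewrite /factor_prod big_nil.
have [irr|] := pselect (irreducible ind (rw v)).
  have [r [k [e cr r1 ar]]] := irreducible_primitive_root c v1 irr.
  exists [:: (r, k)]; split => //; first by rewrite /factor_prod big_seq1.
  move=> f; rewrite inE => /eqP ->; split=> //= s.
  by rewrite e indw_expS.
move=> /existsNP[B /not_implyP[h /not_orP[nB nC]]].
have [x [y [e i ex ey]]] := split_indep h.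
have r := indep_rprod i.
have l : len v = (len x + len y)%N by rewrite e; apply/eqP.
have x1 : x <> 1.
  move=> x1; apply: nC => m mv; apply/negP => Bm.
  have : m \in rw x by rewrite (teq_mem ex) mem_filter Bm.
  by rewrite x1 rw1.
have y1 : y <> 1.
  move=> y1; apply: nB => m mv; apply/negPn/negP => Bm.
  have : m \in rw y by rewrite (teq_mem ey) mem_filter /= Bm.
  by rewrite y1 rw1.
have := len_gt0 x1; have := len_gt0 y1 => ly lx.
have cx : cycred x by apply: indep_cycredl i _; rewrite -e.
have cy : cycred y.
  by apply: indep_cycredl (indep_sym i) _; rewrite -(indep_commute i) -e.
have [|Lx [px wx hx]] := IH x _ cx; first by lia.
have [|Ly [py wy hy]] := IH y _ cy; first by lia.
exists (Lx ++ Ly); split.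
- by rewrite /factor_prod big_cat /= e px py.
- rewrite pairwise_cat wx wy !andbT; apply/allrelP => f g fL gL.
  apply/asboolP; have [_ _ _ sf] := hx f fL; have [_ _ _ sg] := hy g gL.
  exact: indep_subl sf (indep_subr sg i).
move=> f; rewrite mem_cat => /orP[/hx|/hy] [h1 h2 h3 h4]; split=> // s;
  by rewrite e indw_prod // => /andP[] *; apply: h4.
Qed.

Lemma gens_exp x k : cycred x -> (0 < k)%N -> gens (rw (x ^+ k)) =i gens (rw x).
Proof.
case: k => // k c _ s; apply/idP/idP.
  by apply: gens_supported; apply/supported_exp/supported_gens.
rewrite expgS (teq_gens (rw_prod (rprod_expS k c))) gens_cat mem_cat.
by move=> ->.
Qed.

(** * Families of pairwise independent elements *)

Section Family.
Variables (n : nat) (r : 'I_n -> G) (m : 'I_n -> nat).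
Hypothesis mpos : forall i, (0 < m i)%N.
Hypothesis rindep : forall i j, i <> j -> indep (r i) (r j).

Let v := \prod_(i < n) r i ^+ m i.
Let rest i := \prod_(j < n | j != i) r j ^+ m j.

Lemma indep_expr x y k : indep x y -> indep x (y ^+ k).
Proof.
move=> i; elim: k => [|k IH]; first by apply: indep_sym; rewrite expg0; apply: indep1g.
by rewrite expgS; apply: indep_mulr.
Qed.

Lemma indep_expl x y k : indep x y -> indep (x ^+ k) y.
Proof. by move=> /indep_sym/(indep_expr k)/indep_sym. Qed.

Lemma family_indep_rest i : indep (r i) (rest i).
Proof.
apply: (big_ind (indep (r i))) => [|x y|j /eqP ne].
- by apply: indep_sym; apply: indep1g.
- exact: indep_mulr.
by apply/indep_expr/rindep => e; apply: ne.
Qed.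

Lemma family_split i : v = r i ^+ m i * rest i.
Proof.
(* [F] keeps only the factor at [i] and [H] only the others; commutation then separates the two
   products. *)
pose F j := if j == i then r i ^+ m i else 1.
pose H j := if j != i then r j ^+ m j else 1.
have -> : v = \prod_(j < n) (F j * H j).
  apply: eq_bigr => j _; rewrite /F /H.
  by case: eqVneq => [->|_]; rewrite ?mulg1 ?mul1g.
rewrite prodgM_commute; last first.
  move=> j k _ _; rewrite /F /H; case: (j == i); last first.
    by apply: commute_sym; apply: commute1.
  case: eqVneq => [_|/eqP ne] /=; first exact: commute1.
  by apply: commuteX2; apply: indep_commute; apply: rindep => e; apply: ne.
by rewrite -!big_mkcond /= big_pred1_eq.
Qed.

Lemma family_indep_split i : indep (r i ^+ m i) (rest i).
Proof. exact/indep_expl/family_indep_rest. Qed.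

Lemma family_cycred i : cycred v -> cycred (r i).
Proof.
rewrite (family_split i) => /(indep_cycredl (@family_indep_split i)).
exact: cycred_of_exp.
Qed.

(** The other factors involve only generators independent of, hence different from, those of
    [r i]. *)
Lemma family_res i : cycred (r i) ->
  res (mem (gens (rw (r i)))) (rw v) ~ rw (r i ^+ m i).
Proof.
move=> c; have ii := @family_indep_split i; rewrite (family_split i).
apply: teq_trans (teq_res _ (rw_prod (indep_rprod ii))) _.
rewrite /res filter_cat -!/(res _ _) res_id; last first.
  by move=> l lr; rewrite /= -(gens_exp c (mpos i)) gens_mem.
rewrite res_nil ?cats0; first exact: teq_refl.
move=> l lr; apply/negP => /= h.
have /indepP := @family_indep_rest i.
by move=> /(_ _ _ h (gens_mem lr)); rewrite comm_irr.
Qed.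

(** This carries orthogonality from one point of the axis to all others. *)
Lemma family_conj g i s : cycred v -> cycred (v ^ g) ->
  indw ind s (rw (r i)) -> indw ind s (rw (r i ^ g)).
Proof.
move=> c cg si; have cr := family_cycred i c.
have [] := cycred_conj_factor c cg (family_split i) (@family_indep_split i).
rewrite conjXg; have := mpos i; case: (m i) => // k _ ck /(_ s).
by rewrite !indw_expS //; [apply|apply: cycred_of_exp ck].
Qed.

End Family.

(** * Comparison of two decompositions of the same element *)

Section TwoFamilies.
Variables (n n' : nat) (r : 'I_n -> G) (m : 'I_n -> nat).
Variables (r' : 'I_n' -> G) (m' : 'I_n' -> nat).
Hypotheses (mpos : forall i, (0 < m i)%N) (mpos' : forall i, (0 < m' i)%N).
Hypotheses (rind : forall i j, i <> j -> indep (r i) (r j))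
  (rind' : forall i j, i <> j -> indep (r' i) (r' j)).
Hypotheses (rc : forall i, cycred (r i)) (rc' : forall i, cycred (r' i)).
Hypotheses (r1 : forall i, r i <> 1).
Hypotheses (rirr : forall i, irreducible ind (rw (r i))).
Hypothesis eqv : \prod_(i < n) r i ^+ m i = \prod_(i < n') r' i ^+ m' i.

(** Letters of the product outside the support of [r' j] commute with that support, which thus cuts
    [r i] into two commuting parts; irreducibility leaves only one. *)
Lemma family_gens_sub i j s : s \in gens (rw (r i)) -> s \in gens (rw (r' j)) ->
  {subset gens (rw (r i)) <= gens (rw (r' j))}.
Proof.
move=> si sj; pose B := [pred t | t \in gens (rw (r' j))].
have [|all|no] := @rirr i B; last first.
- case/mapP: si => l lr es; have := no l lr.
  by rewrite /= -es sj.
- by move=> t /mapP[l lr ->]; apply: all.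
- move=> l k lr kr Bl Bk.
  have kv : k.1 \in gens (rw (\prod_(i < n) r i ^+ m i)).
    rewrite (family_split m rind i).
    rewrite (teq_gens (rw_prod (indep_rprod (@family_indep_split _ r m rind i)))).
    by rewrite gens_cat mem_cat (gens_exp (rc i) (mpos i)) gens_mem.
  have i1 := @family_indep_split _ r' m' rind' j.
  move: kv; rewrite eqv (family_split m' rind' j) (teq_gens (rw_prod (indep_rprod i1))).
  rewrite gens_cat mem_cat (gens_exp (rc' j) (mpos' j)).
  move=> /orP[h|kr']; first by rewrite /B /= h in Bk.
  by have /indepP := @family_indep_rest _ r' m' rind' j; apply.
Qed.

Lemma family_match i : exists j s, s \in gens (rw (r i)) /\ s \in gens (rw (r' j)).
Proof.
have [s si] : exists s, s \in gens (rw (r i)).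
  by case: (rw (r i)) (rw_neq0 (@r1 i)) => // l u _; exists l.1; rewrite mem_head.
apply: contrapT => none.
have : supported (predC1 s) (\prod_(i < n) r i ^+ m i).
  rewrite eqv; apply: (big_ind (fun x => supported (predC1 s) x)) => [|x y|j _].
  - by rewrite /supported rw1.
  - exact: supported_mul.
  apply: supported_exp; apply/allP => l lr; apply/eqP => e.
  by apply: none; exists j, s; rewrite -{2}e gens_mem.
move/gens_supported => /(_ s); rewrite (family_split m rind i).
rewrite (teq_gens (rw_prod (indep_rprod (@family_indep_split _ r m rind i)))).
rewrite gens_cat mem_cat (gens_exp (rc i) (mpos i)) si => /(_ isT).
by rewrite inE eqxx.
Qed.

(** Both powers are the restriction of the common product to the same generators. *)
Lemma family_eq_power i j : gens (rw (r i)) =i gens (rw (r' j)) ->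
  r i ^+ m i = r' j ^+ m' j.
Proof.
move=> eg.
have k1 := @family_res _ r m mpos rind i (rc i).
have k2 := @family_res _ r' m' mpos' rind' j (rc' j).
rewrite -(rwK (r i ^+ m i)) -(rwK (r' j ^+ m' j)) -(teq_val k1) -(teq_val k2).
by rewrite eqv; congr val; apply: eq_filter => l; rewrite /= eg.
Qed.

End TwoFamilies.

Lemma eq_exp_commute x y j k : cycred x -> cycred y -> x ^+ j.+1 = y ^+ k.+1 ->
  commute x y.
Proof.
move=> cx cy e; have h : tpow j.+1 (rw x) ~ tpow k.+1 (rw y).
  apply: teq_trans (teq_sym (rw_exp _ cx)) _; rewrite e; exact: rw_exp.
by have := teq_val (eq_pow_commute h); rewrite !word_val_cat !rwK.
Qed.

(** The element [y] lies between 1 and [y ^+ k.+1], which is a power of [x], hence in the convex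
    closure. *)
Lemma eq_exp_zpowers x y j k : cycred x -> cycred y -> axis_cyclic x ->
  x ^+ j.+1 = y ^+ k.+1 -> zpowers x y.
Proof.
move=> cx cy ax e; rewrite -ax; split=> /=.
  by apply/commute_sym; apply: eq_exp_commute e.
rewrite -(mul1g y); apply: (@axis1_between _ _ (x ^+ j.+1)).
- by apply: zpowers_axis1; exists 0%N; left; rewrite expg0.
- by rewrite mul1g; exact: zpowers_axis1 (zpowers_exp x j.+1).
by apply/prefixP; exists (y ^+ k); rewrite ?e ?expgS ?rprod_expS.
Qed.

(** Each element is a power of the other up to sign, so their lengths agree, and then the exponents
    do. *)
Lemma eq_exp_primitive x y j k : cycred x -> cycred y -> x <> 1 -> y <> 1 ->
  axis_cyclic x -> axis_cyclic y -> x ^+ j.+1 = y ^+ k.+1 -> x = y /\ j = k.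
Proof.
move=> cx cy x1 y1 ax ay e.
have zy := eq_exp_zpowers cx cy ax e; have zx := eq_exp_zpowers cy cx ay (esym e).
have [a ea] := zpowers_len cx zy; have [b eb] := zpowers_len cy zx.
have lx := len_gt0 x1; have ly := len_gt0 y1.
have el : len x = len y.
  apply/eqP; rewrite eqn_leq.
  have a0 : (0 < a)%N by case: (a) ea => // h; rewrite h in ly.
  have b0 : (0 < b)%N by case: (b) eb => // h; rewrite h in lx.
  by apply/andP; split; [rewrite ea|rewrite eb]; apply: leq_pmull.
have ejk : j = k.
  have := congr1 len e; rewrite !len_exp // el => /eqP.
  by rewrite eqn_pmul2r // => /eqP[].
split=> //; case: zy => c [ey|ey].
  have := congr1 len ey; rewrite len_exp // -el -{1}[len x]mul1n => /eqP.
  by rewrite eqn_pmul2r // => /eqP c1; rewrite ey -c1 expg1.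
have := congr1 len ey; rewrite lenV len_exp // -el -{1}[len x]mul1n => /eqP.
rewrite eqn_pmul2r // => /eqP c1; rewrite -c1 expg1 in ey.
(* Here [y = x^-1], which would make a positive power of [x] trivial, although lengths multiply in
   powers. *)
have : x ^+ (j.+1 + k.+1) = 1 by rewrite expgnDr e ey expVgn mulVg.
by move=> /(congr1 len); rewrite len_exp // len1; lia.
Qed.

Lemma conjE x y : y^-1 * x * y = x ^ y.
Proof. by rewrite /conjg mulgA. Qed.

Lemma primitive_axis_cyclic (p g : G) : primitive S p -> cycred (p ^ g) ->
  axis_cyclic (p ^ g).
Proof.
move=> [_ [b /axisP]]; rewrite conjE => cb ab c.
rewrite -(mulVKg b g) conjgM; apply: axis_cyclic_conj => //.
by rewrite -conjgM mulVKg.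
Qed.

(** * Primitive decompositions at a point of the axis *)

Section Decomposition.
Variables (w : G) (n : nat) (p : 'I_n -> G) (m : 'I_n -> nat) (g : G).
Hypotheses (dec : primitive_decomposition S w p m) (wg : axis S w g).
Let r i := p i ^ g.

Lemma decomposition_indep i j : i <> j -> indep (r i) (r j).
Proof.
case: dec => _ _ h _ ij; have /orthogonalP := h i j g ij wg.
by rewrite !conjE.
Qed.

Lemma decomposition_prod : w ^ g = \prod_(i < n) r i ^+ m i.
Proof.
by case: dec => _ _ _ ->; rewrite conjg_prod; apply: eq_bigr => i _; rewrite conjXg.
Qed.

Lemma decomposition_cycred i : cycred (r i).
Proof.
case: dec => _ mpos _ _; apply: (family_cycred mpos decomposition_indep).
by rewrite -decomposition_prod; move/axisP: wg; rewrite conjE.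
Qed.

Lemma decomposition_axis_cyclic i : axis_cyclic (r i).
Proof.
by apply: primitive_axis_cyclic; [case: dec | apply: decomposition_cycred].
Qed.

Lemma decomposition_neq1 i : r i <> 1.
Proof.
case: dec => /(_ i)[p1 _] _ _ _ e; apply: p1.
by apply: (@conjg_inj _ g); rewrite conj1g.
Qed.

Lemma decomposition_irreducible i : irreducible ind (rw (r i)).
Proof.
apply: axis_cyclic_irreducible; first exact: decomposition_cycred.
  exact: decomposition_neq1.
exact: decomposition_axis_cyclic.
Qed.

(** Equal factors at different indices would be independent of themselves, hence trivial. *)
Lemma decomposition_inj : injective p.
Proof.
move=> i j e; apply/eqP/negPn/negP => /eqP ij.
have /first_exists[a fa] := @decomposition_neq1 i.
have := indep_first (decomposition_indep ij) fa.
by rewrite /r -e => /indw_firstN; rewrite fa.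
Qed.

Lemma decomposition_commute i j : commute (p i) (p j).
Proof.
have [->|/eqP ij] := eqVneq i j; first exact: commute_refl.
apply: (@conjg_inj _ g); rewrite !conjMg.
exact: indep_commute (decomposition_indep ij).
Qed.

End Decomposition.

Lemma axis_exists w : exists g, axis S w g.
Proof. by exists (phi S w 1), 1. Qed.

Lemma decomposition_exists w : exists n (p : 'I_n -> G) (m : 'I_n -> nat),
  primitive_decomposition S w p m.
Proof.
have [g wg] := axis_exists w.
have cv : cycred (w ^ g) by move/axisP: wg; rewrite conjE.
have [L [e wise hL]] := cycred_decomposition cv.
pose f := nth (1 : G, 0%N) L.
have fL (i : 'I_(size L)) : f i \in L by apply: mem_nth.
have lti (i j : 'I_(size L)) : (i < j)%N -> indep (f i).1 (f j).1.
  have /(pairwiseP (1 : G, 0%N)) h := wise.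
  by move=> lt; apply/asboolP; apply: h; rewrite ?inE.
have ri (i j : 'I_(size L)) : i <> j -> indep (f i).1 (f j).1.
  by move=> /eqP; rewrite neq_ltn => /orP[/lti|/lti/indep_sym].
have ev : w ^ g = \prod_(i < size L) (f i).1 ^+ (f i).2.+1.
  by rewrite e /factor_prod (big_nth (1 : G, 0%N)) big_mkord.
(* The factors were found at the point [g] and are conjugated back. *)
exists (size L), (fun i => (f i).1 ^ g^-1), (fun i => (f i).2.+1); split => //.
- move=> i; have [c f1 ac _] := hL _ (fL i); split.
    by move=> h; apply: f1; apply: (@conjg_inj _ g^-1); rewrite conj1g.
  have ef : g^-1 * (f i).1 ^ g^-1 * g = (f i).1 by rewrite conjE conjgKV.
  by exists g; rewrite ?axisP ef.
(* At another point [b] the conjugate of [w] arises from the one at [g] by conjugation with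
   [g^-1 * b]; both are cyclically reduced, so independence is inherited. *)
- move=> i j b ij /axisP; rewrite conjE => cb.
  apply/orthogonalP; rewrite !conjE -!conjgM.
  have cv' : cycred (\prod_(i < size L) (f i).1 ^+ (f i).2.+1) by rewrite -ev.
  have cb' : cycred ((\prod_(i < size L) (f i).1 ^+ (f i).2.+1) ^ (g^-1 * b)).
    by rewrite -ev -conjgM mulVKg.
  have mpos (k : 'I_(size L)) : (0 < (f k).2.+1)%N by [].
  have sub k s := @family_conj _ _ _ mpos ri (g^-1 * b) k s cv' cb'.
  exact: indep_subl (sub i) (indep_subr (sub j) (ri i j ij)).
apply: (@conjg_inj _ g); rewrite ev conjg_prod; apply: eq_bigr => i _.
by rewrite conjXg conjgKV.
Qed.

(** At a point of the axis a factor shares a generator with some factor of the other decomposition.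
    Irreducibility makes their supports equal, so the powers agree, and primitivity then gives equal
    bases and exponents. *)
Lemma decomposition_match w n (p : 'I_n -> G) m n' (p' : 'I_n' -> G) m' :
  primitive_decomposition S w p m -> primitive_decomposition S w p' m' ->
  forall i, exists j, p' j = p i /\ m' j = m i.
Proof.
move=> d d' i; have [g wg] := axis_exists w.
have [_ mpos _ _] := d; have [_ mpos' _ _] := d'.
have rind := decomposition_indep d wg; have rind' := decomposition_indep d' wg.
have rc := decomposition_cycred d wg; have rc' := decomposition_cycred d' wg.
have r1 := decomposition_neq1 d (g := g); have r1' := decomposition_neq1 d' (g := g).
have ir := decomposition_irreducible d wg; have ir' := decomposition_irreducible d' wg.
have eqv : \prod_(i < n) (p i ^ g) ^+ m i = \prod_(i < n') (p' i ^ g) ^+ m' i.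
  by rewrite -(decomposition_prod g d) -(decomposition_prod g d').
have [j [s [si sj]]] := family_match mpos rind rc r1 eqv i.
have eg : gens (rw (p i ^ g)) =i gens (rw (p' j ^ g)).
  move=> t; apply/idP/idP.
    exact: (family_gens_sub mpos mpos' rind rind' rc rc' ir eqv si sj).
  exact: (family_gens_sub mpos' mpos rind' rind rc' rc ir' (esym eqv) sj si).
have h := family_eq_power mpos mpos' rind rind' rc rc' eqv eg.
exists j; have := mpos i; have := mpos' j; move: h.
case: (m i) (m' j) => // k [//|k'] h _ _.
have [e ->] := eq_exp_primitive (rc i) (rc' j) (@r1 i) (@r1' j)
  (decomposition_axis_cyclic d wg i) (decomposition_axis_cyclic d' wg j) h.
by split=> //; apply: (@conjg_inj _ g).
Qed.

End Artin.

Theorem theorem8p9 (G : groupType) (S : set G) (hS : right_angled_artin S)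
    (w : G) :
  [/\ exists (n : nat) (p : 'I_n -> G) (m : 'I_n -> nat),
        primitive_decomposition S w p m,
      forall (n : nat) (p : 'I_n -> G) (m : 'I_n -> nat),
        primitive_decomposition S w p m -> forall i j, commute (p i) (p j) &
      forall (n : nat) (p : 'I_n -> G) (m : 'I_n -> nat)
             (n' : nat) (p' : 'I_n' -> G) (m' : 'I_n' -> nat),
        primitive_decomposition S w p m -> primitive_decomposition S w p' m' ->
        exists2 s : 'I_n -> 'I_n', bijective s &
          forall i, p' (s i) = p i /\ m' (s i) = m i].
Proof.
have [g wg] := axis_exists S w.
split; first exact: decomposition_exists.
  by move=> n p m d; apply: decomposition_commute d wg.
move=> n p m n' p' m' d d'.
(* The matchings in the two directions are mutually inverse because the bases within one
   decomposition are distinct. *)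
have [s hs] := choice (decomposition_match hS d d').
have [s' hs'] := choice (decomposition_match hS d' d).
exists s => //; exists s'.
  move=> i; apply: (decomposition_inj hS d wg).
  by rewrite (hs' _).1 (hs _).1.
move=> j; apply: (decomposition_inj hS d' wg).
by rewrite (hs _).1 (hs' _).1.
Qed.
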